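(* Let $\Gamma$ be a green Veldkamp quadrangle and let $\bar\Gamma$ be the graph with local opposition relations defined below. Then $\bar\Gamma$ is a flat green Veldkamp quadrangle (with point set $\bar P$ and line set $\bar L$). Moreover, $\Gamma$ is flat if and only if all classes $[a]$ ($a\in P$) and $[x]$ ($x\in L$) are singletons, i.e. $\bar\Gamma$ can be identified with $\Gamma$. Furthermore, if $\Gamma$ is $k$-plump for some $k\ge3$, then so is $\bar\Gamma$.
   Context: A graph is a pair $(V,E)$ with $E$ a set of $2$-element subsets of $V$; $\Gamma_v$ is the set of neighbors of $v$. An $s$-path is a sequence $(x_0,\dots,x_s)$ of vertices with consecutive vertices adjacent and $x_{i-2}\ne x_i$ for $i\in[2,s]$; ${\rm dist}$ is graph distance. A closed $s$-path is an $s$-path with $s\ge3$ whose first and last vertices coincide; an $s$-circuit is the subgraph determined by a closed $s$-path. An opposition relation on a set $X$ is a symmetric anti-reflexive relation; trivial if any two distinct elements are related; $k$-plump if for every $S\subseteq X$ with $|S|\le k$ some element of $X$ is related to all elements of $S$. A Veldkamp graph is a graph with a $2$-plump opposition relation $\equiv_v$ on $\Gamma_v$ for each vertex $v$; it is $k$-plump if all $\equiv_v$ are. A path $(v_0,\dots,v_s)$ is straight if $v_{i-1}\equiv_{v_i}v_{i+1}$ for all $i\in[1,s-1]$; a circuit is straight if every path in it is straight. A Veldkamp $n$-gon ($n\ge2$) is a Veldkamp graph satisfying (VP1) connected and bipartite; (VP2) for each $k\in[1,n-1]$ each straight $k$-path is the unique straight path between its endpoints of length at most $k$; (VP3) every straight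 $(n+1)$-path lies in a straight $2n$-circuit. A root is a straight $n$-path; two vertices are opposite if there is a root between them; $x^{\rm op}$ is the set of vertices opposite $x$; the polygon is flat if $x^{\rm op}=y^{\rm op}$ implies $x=y$. A Veldkamp quadrangle is a Veldkamp $4$-gon, with bipartition classes called points $P$ and lines $L$; it is green if $\equiv_x$ is trivial for every line $x$. A weed is a non-straight $4$-path $(a,x,b,y,c)$ with $a,b,c\in P$ and ${\rm dist}(a,c)=4$. For $a,b\in P$, $a\simeq b$ means $a=b$ or there is a weed from $a$ to $b$; this is an equivalence relation on $P$, with class $[a]$. For $x,y\in L$, $x\sim y$ means some weed contains both $x$ and $y$; $\approx$ is the reflexive-transitive closure of $\sim$, with class $[x]$. The graph $\bar\Gamma$: its vertex set is the disjoint union of $\bar P=\{[a]\mid a\in P\}$ and $\bar L=\{[x]\mid x\in L\}$; $[a]$ and $[x]$ are adjacent iff some element of $[a]$ is adjacent in $\Gamma$ to some element of $[x]$. Two neighbors of $[x]\in\bar L$ are opposite at $[x]$ iff they are distinct; two neighbors $[x],[y]$ of $[a]\in\bar P$ are opposite at $[a]$ iff there is a point $b\in[a]$ such that every line in $\Gamma_b\cap[x]$ is opposite (at $b$) every line in $\Gamma_b\cap[y]$. *)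

(* Defs.v *)
(* Graphs are arbitrary (possibly infinite) types with a
   Prop-valued adjacency relation; local opposition relations are given by
   a ternary predicate [opp v x y] meaning  x ==_v y  (x, y in Gamma_v). *)
From Stdlib Require Import List Relations.
Import ListNotations.

Section Graphs.
Context {V : Type} (adj : V -> V -> Prop) (opp : V -> V -> V -> Prop).

Definition is_graph : Prop :=
  (forall x y, adj x y -> adj y x) /\ (forall x, ~ adj x x).

Fixpoint is_walk (l : list V) : Prop :=
  match l with
  | [] => False
  | [x] => True
  | x :: ((y :: _) as t) => adj x y /\ is_walk t
  end.

Fixpoint is_path (l : list V) : Prop :=
  match l with
  | [] => False
  | [x] => True
  | x :: ((y :: l') as t) =>
      adj x y /\ is_path t /\ match l' with z :: _ => x <> z | [] => True end
  end.

Definition spath (s : nat) (l : list V) : Prop := is_path l /\ length l = S s.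

Definition between (l : list V) (a b : V) : Prop :=
  hd_error l = Some a /\ last l a = b.

Fixpoint straight_aux (l : list V) : Prop :=
  match l with
  | x :: ((y :: ((z :: _) as t2)) as t) => opp y x z /\ straight_aux t
  | _ => True
  end.

Definition straight (l : list V) : Prop := is_path l /\ straight_aux l.

Definition dist_is (a c : V) (n : nat) : Prop :=
  (exists w, is_walk w /\ between w a c /\ length w = S n) /\
  (forall w m, is_walk w -> between w a c -> length w = S m -> n <= m).

Definition closed_path (s : nat) (c : list V) : Prop :=
  spath s c /\ 3 <= s /\ exists a, between c a a.

Definition circ_edge (c : list V) (u w : V) : Prop :=
  exists i, S i < length c /\
    ((nth i c u = u /\ nth (S i) c u = w) \/ (nth i c u = w /\ nth (S i) c u = u)).

Fixpoint edges_in (E : V -> V -> Prop) (l : list V) : Prop :=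
  match l with
  | x :: ((y :: _) as t) => E x y /\ edges_in E t
  | _ => True
  end.

Definition path_in_circ (c p : list V) : Prop :=
  (forall v, In v p -> In v c) /\ edges_in (circ_edge c) p.

Definition straight_circ (c : list V) : Prop :=
  forall p, is_path p -> path_in_circ c p -> straight p.

Definition opp_rel_at (v : V) : Prop :=
  (forall x y, opp v x y -> adj v x /\ adj v y) /\
  (forall x y, opp v x y -> opp v y x) /\
  (forall x, ~ opp v x x).

Definition trivial_at (v : V) : Prop :=
  forall x y, adj v x -> adj v y -> x <> y -> opp v x y.

(* k-plump at v: every subset S of Gamma_v with |S| <= k (given as a list of
   length <= k) has an element of Gamma_v opposite to all its elements *)
Definition plump_at (k : nat) (v : V) : Prop :=
  forall S : list V, length S <= k -> (forall s, In s S -> adj v s) ->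
    exists x, adj v x /\ forall s, In s S -> opp v x s.

Definition veldkamp_graph : Prop :=
  is_graph /\ forall v, opp_rel_at v /\ plump_at 2 v.

Definition kplump (k : nat) : Prop := forall v, plump_at k v.

Definition connected : Prop := forall x y, exists w, is_walk w /\ between w x y.

Definition bipartite : Prop :=
  exists f : V -> bool, forall x y, adj x y -> f x <> f y.

Definition veldkamp_ngon (n : nat) : Prop :=
  2 <= n /\ veldkamp_graph /\
  (* VP1 *) (connected /\ bipartite) /\
  (* VP2 *) (forall k, 1 <= k <= n - 1 -> forall p a b,
               spath k p -> straight p -> between p a b ->
               forall q, straight q -> between q a b -> length q <= S k -> q = p) /\
  (* VP3 *) (forall p, spath (n + 1) p -> straight p ->
               exists c, closed_path (2 * n) c /\ straight_circ c /\ path_in_circ c p).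

Definition opposite (n : nat) (x y : V) : Prop :=
  exists r, spath n r /\ straight r /\ between r x y.

Definition flat (n : nat) : Prop :=
  forall x y, (forall z, opposite n x z <-> opposite n y z) -> x = y.

End Graphs.

Section Quadrangles.
Context {V : Type} (adj : V -> V -> Prop) (opp : V -> V -> V -> Prop) (pt : V -> Prop).
(* pt = the point class P; lines are the vertices not in P *)

Definition veldkamp_quadrangle : Prop :=
  veldkamp_ngon adj opp 4 /\ (forall x y, adj x y -> (pt x <-> ~ pt y)).

Definition green : Prop := forall x, ~ pt x -> trivial_at adj opp x.

Definition weed (a x b y c : V) : Prop :=
  is_path adj [a; x; b; y; c] /\ ~ straight adj opp [a; x; b; y; c] /\
  pt a /\ pt b /\ pt c /\ dist_is adj a c 4.

Definition psim (a b : V) : Prop := a = b \/ exists x b' y, weed a x b' y b.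

Definition lsim (x y : V) : Prop :=
  ~ pt x /\ ~ pt y /\
  exists a x' b y' c, weed a x' b y' c /\ In x [a; x'; b; y'; c] /\ In y [a; x'; b; y'; c].

Definition pclass (a : V) : V -> Prop := psim a.
Definition lclass (x : V) : V -> Prop := clos_refl_trans V lsim x.

Definition is_class (C : V -> Prop) : Prop :=
  (exists a, pt a /\ C = pclass a) \/ (exists x, ~ pt x /\ C = lclass x).

Definition Vbar : Type := { C : V -> Prop | is_class C }.

Definition ptbar (C : Vbar) : Prop := exists a, pt a /\ proj1_sig C = pclass a.
Definition linebar (C : Vbar) : Prop := exists x, ~ pt x /\ proj1_sig C = lclass x.

Definition adjbar (C D : Vbar) : Prop :=
  ((ptbar C /\ linebar D) \/ (linebar C /\ ptbar D)) /\
  exists u v, proj1_sig C u /\ proj1_sig D v /\ adj u v.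

Definition oppbar (W C D : Vbar) : Prop :=
  adjbar W C /\ adjbar W D /\
  ((linebar W /\ C <> D) \/
   (ptbar W /\ exists b, proj1_sig W b /\
      forall u v, adj b u -> proj1_sig C u -> adj b v -> proj1_sig D v -> opp b u v)).

End Quadrangles.

(* Main.v *)
Require Import Defs.
From Stdlib Require Import List Relations Lia.
From Stdlib Require Import Classical ClassicalEpsilon.
From Stdlib Require Import FunctionalExtensionality PropExtensionality.
Import ListNotations.

(* Call two points near if they are not opposite.  Completing a root and a further
   line to an octagon shows that each line carries exactly one point, or only
   points, near a given point: the one-or-all axiom of polar spaces.  Near points
   that are not collinear have the same opposite points; these are exactly the
   pairs joined by a weed, so [a] = [b] iff a and b have the same opposites.
   Call the set of classes [a] met by a line its trace.  As in the theorem of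
   Buekenhout and Shult, two lines whose traces share two classes have equal
   traces, and x, y lie in one class iff their traces agree.  So the quotient is a
   nondegenerate polar space in which distinct near points are collinear, lines at
   a point are opposite iff they contain opposite points, and every axiom follows
   from one-or-all.  Flatness, for any green quadrangle, means that points with
   the same opposites coincide and lines with the same trace coincide; the
   quotient has this property because opposition of points passes to it. *)

(** * Octagons *)

Section Octagons.
Context {V : Type}.

Definition octagon (c0 c1 c2 c3 c4 c5 c6 c7 : V) : list V :=
  [c0; c1; c2; c3; c4; c5; c6; c7; c0].

Lemma octagon_edge c0 c1 c2 c3 c4 c5 c6 c7 u w :
  circ_edge (octagon c0 c1 c2 c3 c4 c5 c6 c7) u w <->
  (u = c0 /\ w = c1) \/ (u = c1 /\ w = c2) \/ (u = c2 /\ w = c3) \/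
  (u = c3 /\ w = c4) \/ (u = c4 /\ w = c5) \/ (u = c5 /\ w = c6) \/
  (u = c6 /\ w = c7) \/ (u = c7 /\ w = c0) \/
  (w = c0 /\ u = c1) \/ (w = c1 /\ u = c2) \/ (w = c2 /\ u = c3) \/
  (w = c3 /\ u = c4) \/ (w = c4 /\ u = c5) \/ (w = c5 /\ u = c6) \/
  (w = c6 /\ u = c7) \/ (w = c7 /\ u = c0).
Proof.
  unfold circ_edge, octagon; split.
  - intros [i [Hi H]]; simpl in Hi.
    do 8 (destruct i as [|i]; [simpl in H; intuition (subst; auto 20)|]).
    lia.
  - intros H.
    repeat (destruct H as [[-> ->]|H];
      [first [ exists 0; split; [simpl; lia|simpl; tauto]
             | exists 1; split; [simpl; lia|simpl; tauto]
             | exists 2; split; [simpl; lia|simpl; tauto]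
             | exists 3; split; [simpl; lia|simpl; tauto]
             | exists 4; split; [simpl; lia|simpl; tauto]
             | exists 5; split; [simpl; lia|simpl; tauto]
             | exists 6; split; [simpl; lia|simpl; tauto]
             | exists 7; split; [simpl; lia|simpl; tauto] ]|]).
    destruct H as [-> ->]; exists 7; split; [simpl; lia|simpl; tauto].
Qed.

Lemma octagon_edge_sym c0 c1 c2 c3 c4 c5 c6 c7 u w :
  circ_edge (octagon c0 c1 c2 c3 c4 c5 c6 c7) u w ->
  circ_edge (octagon c0 c1 c2 c3 c4 c5 c6 c7) w u.
Proof. rewrite !octagon_edge; tauto. Qed.

Lemma octagon_edge_In c0 c1 c2 c3 c4 c5 c6 c7 u w :
  let o := octagon c0 c1 c2 c3 c4 c5 c6 c7 in circ_edge o u w -> In u o /\ In w o.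
Proof.
  intros o H; apply octagon_edge in H; simpl.
  repeat (destruct H as [[-> ->]|H]; [tauto|]); destruct H as [-> ->]; tauto.
Qed.

(** Only the vertex [c1] is treated; rotating the octagon carries the statement to the other
    vertices. *)
Lemma octagon_next c0 c1 c2 c3 c4 c5 c6 c7 w :
  NoDup [c0; c1; c2; c3; c4; c5; c6; c7] ->
  circ_edge (octagon c0 c1 c2 c3 c4 c5 c6 c7) c1 w -> w = c0 \/ w = c2.
Proof.
  rewrite octagon_edge; intros HN H.
  repeat match goal with
  | H : NoDup (_ :: _) |- _ =>
      let h := fresh in inversion H as [|? ? h ?]; clear H; subst; simpl in h
  end.
  intuition congruence.
Qed.

Lemma NoDup_rot (c0 c1 c2 c3 c4 c5 c6 c7 : V) :
  NoDup [c0; c1; c2; c3; c4; c5; c6; c7] ->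
  NoDup [c1; c2; c3; c4; c5; c6; c7; c0].
Proof.
  intros H; apply (NoDup_Add (a := c0) (l := [c1; c2; c3; c4; c5; c6; c7])).
  - repeat constructor.
  - inversion H; auto.
Qed.

Lemma octagon_rot c0 c1 c2 c3 c4 c5 c6 c7 u w :
  circ_edge (octagon c0 c1 c2 c3 c4 c5 c6 c7) u w ->
  circ_edge (octagon c1 c2 c3 c4 c5 c6 c7 c0) u w.
Proof. rewrite !octagon_edge; tauto. Qed.

Lemma octagon_rev c0 c1 c2 c3 c4 c5 c6 c7 u w :
  circ_edge (octagon c0 c1 c2 c3 c4 c5 c6 c7) u w ->
  circ_edge (octagon c7 c6 c5 c4 c3 c2 c1 c0) u w.
Proof. rewrite !octagon_edge; tauto. Qed.

(** [R u v w] will express opposition of [u] and [w] at [v], required here all the way around. *)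
Definition cyclic (R : V -> V -> V -> Prop) (c0 c1 c2 c3 c4 c5 c6 c7 : V) : Prop :=
  (R c0 c1 c2 /\ R c1 c2 c3 /\ R c2 c3 c4 /\ R c3 c4 c5) /\
  (R c4 c5 c6 /\ R c5 c6 c7 /\ R c6 c7 c0 /\ R c7 c0 c1).

(** The two types alternate, so only positions of equal parity have to be compared. *)
Lemma octagon_NoDup (P : V -> Prop) c0 c1 c2 c3 c4 c5 c6 c7 :
  (P c0 /\ P c2 /\ P c4 /\ P c6) -> (~ P c1 /\ ~ P c3 /\ ~ P c5 /\ ~ P c7) ->
  (c0 <> c2 /\ c0 <> c4 /\ c0 <> c6 /\ c2 <> c4 /\ c2 <> c6 /\ c4 <> c6) ->
  (c1 <> c3 /\ c1 <> c5 /\ c1 <> c7 /\ c3 <> c5 /\ c3 <> c7 /\ c5 <> c7) ->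
  NoDup [c0; c1; c2; c3; c4; c5; c6; c7].
Proof.
  intros [? [? [? ?]]] [? [? [? ?]]] [? [? [? [? [? ?]]]]] [? [? [? [? [? ?]]]]].
  repeat (apply NoDup_cons; [simpl; intros F; repeat destruct F as [F|F];
    first [contradiction | subst; contradiction | congruence]|]); apply NoDup_nil.
Qed.

(** A walk of five edges that never turns back follows the octagon in one direction, and the two
    vertices left over close it up. Rotations and a reversal reduce this to a walk that starts with
    [c0], [c1]. *)
Lemma octagon_completion (R : V -> V -> V -> Prop) c0 c1 c2 c3 c4 c5 c6 c7
    v0 v1 v2 v3 v4 v5 :
  (forall u v w, R u v w -> R w v u) ->
  NoDup [c0; c1; c2; c3; c4; c5; c6; c7] ->
  cyclic R c0 c1 c2 c3 c4 c5 c6 c7 ->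
  let E := circ_edge (octagon c0 c1 c2 c3 c4 c5 c6 c7) in
  E v0 v1 -> E v1 v2 -> E v2 v3 -> E v3 v4 -> E v4 v5 ->
  v0 <> v2 -> v1 <> v3 -> v2 <> v4 -> v3 <> v5 ->
  exists v6 v7, cyclic R v0 v1 v2 v3 v4 v5 v6 v7.
Proof.
  intros Rsym.
  assert (forward : forall c0 c1 c2 c3 c4 c5 c6 c7,
    NoDup [c0; c1; c2; c3; c4; c5; c6; c7] -> cyclic R c0 c1 c2 c3 c4 c5 c6 c7 ->
    let E := circ_edge (octagon c0 c1 c2 c3 c4 c5 c6 c7) in
    E c1 v2 -> E v2 v3 -> E v3 v4 -> E v4 v5 ->
    c0 <> v2 -> c1 <> v3 -> v2 <> v4 -> v3 <> v5 ->
    exists v6 v7, cyclic R c0 c1 v2 v3 v4 v5 v6 v7).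
  { clear; intros c0 c1 c2 c3 c4 c5 c6 c7 HN HR E E1 E2 E3 E4 n1 n2 n3 n4.
    assert (v2 = c2) as ->.
    { destruct (octagon_next _ _ _ _ _ _ _ _ _ HN E1); congruence. }
    apply NoDup_rot in HN; apply octagon_rot in E2, E3, E4.
    assert (v3 = c3) as ->.
    { destruct (octagon_next _ _ _ _ _ _ _ _ _ HN E2); congruence. }
    apply NoDup_rot in HN; apply octagon_rot in E3, E4.
    assert (v4 = c4) as ->.
    { destruct (octagon_next _ _ _ _ _ _ _ _ _ HN E3); congruence. }
    apply NoDup_rot in HN; apply octagon_rot in E4.
    assert (v5 = c5) as ->.
    { destruct (octagon_next _ _ _ _ _ _ _ _ _ HN E4); congruence. }
    exists c6, c7; exact HR. }
  assert (oriented : forall n c0 c1 c2 c3 c4 c5 c6 c7,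
    NoDup [c0; c1; c2; c3; c4; c5; c6; c7] -> cyclic R c0 c1 c2 c3 c4 c5 c6 c7 ->
    let E := circ_edge (octagon c0 c1 c2 c3 c4 c5 c6 c7) in
    E v1 v2 -> E v2 v3 -> E v3 v4 -> E v4 v5 ->
    v0 <> v2 -> v1 <> v3 -> v2 <> v4 -> v3 <> v5 ->
    n < 8 -> v0 = nth n [c0; c1; c2; c3; c4; c5; c6; c7] v0 ->
    v1 = nth n [c1; c2; c3; c4; c5; c6; c7; c0] v1 ->
    exists v6 v7, cyclic R v0 v1 v2 v3 v4 v5 v6 v7).
  { induction n as [|n IH]; intros d0 d1 d2 d3 d4 d5 d6 d7 HN HR E E1 E2 E3 E4 n1 n2 n3 n4 Hn H0 H1.
    - simpl in H0, H1; subst; eapply forward; eauto.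
    - apply (IH d1 d2 d3 d4 d5 d6 d7 d0); auto using NoDup_rot, octagon_rot; try lia.
      + unfold cyclic in *; tauto.
      + do 7 (destruct n as [|n]; [exact H0|]); lia.
      + do 7 (destruct n as [|n]; [exact H1|]); lia. }
  intros HN HR E E0 E1 E2 E3 E4 n1 n2 n3 n4.
  assert (HN' : NoDup [c7; c6; c5; c4; c3; c2; c1; c0]).
  { apply (NoDup_rev HN). }
  assert (HR' : cyclic R c7 c6 c5 c4 c3 c2 c1 c0).
  { unfold cyclic in *; intuition. }
  (* The first edge is one of sixteen directed edges: eight along the octagon and eight along its
     reversal. *)
  pose proof E0 as E0'. apply octagon_edge in E0'.
  repeat (destruct E0' as [E0'|E0']).
  1-8: [> apply (oriented 0 c0 c1 c2 c3 c4 c5 c6 c7) | apply (oriented 1 c0 c1 c2 c3 c4 c5 c6 c7)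
   | apply (oriented 2 c0 c1 c2 c3 c4 c5 c6 c7) | apply (oriented 3 c0 c1 c2 c3 c4 c5 c6 c7)
   | apply (oriented 4 c0 c1 c2 c3 c4 c5 c6 c7) | apply (oriented 5 c0 c1 c2 c3 c4 c5 c6 c7)
   | apply (oriented 6 c0 c1 c2 c3 c4 c5 c6 c7) | apply (oriented 7 c0 c1 c2 c3 c4 c5 c6 c7)];
   auto; try lia; simpl; tauto.
  1-8: [> apply (oriented 6 c7 c6 c5 c4 c3 c2 c1 c0) | apply (oriented 5 c7 c6 c5 c4 c3 c2 c1 c0)
   | apply (oriented 4 c7 c6 c5 c4 c3 c2 c1 c0) | apply (oriented 3 c7 c6 c5 c4 c3 c2 c1 c0)
   | apply (oriented 2 c7 c6 c5 c4 c3 c2 c1 c0) | apply (oriented 1 c7 c6 c5 c4 c3 c2 c1 c0)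
   | apply (oriented 0 c7 c6 c5 c4 c3 c2 c1 c0) | apply (oriented 7 c7 c6 c5 c4 c3 c2 c1 c0)];
   auto using octagon_rev; try lia; simpl; tauto.
Qed.

(** The neighbours of [v] are its predecessor and its successor, so the triple is consecutive in one
    of the two directions. *)
Lemma octagon_triple (R : V -> V -> V -> Prop) c0 c1 c2 c3 c4 c5 c6 c7 u v w :
  (forall u v w, R u v w -> R w v u) ->
  NoDup [c0; c1; c2; c3; c4; c5; c6; c7] ->
  cyclic R c0 c1 c2 c3 c4 c5 c6 c7 ->
  let E := circ_edge (octagon c0 c1 c2 c3 c4 c5 c6 c7) in
  E u v -> E v w -> u <> w -> R u v w.
Proof.
  intros Rsym.
  assert (at1 : forall c0 c1 c2 c3 c4 c5 c6 c7,
    NoDup [c0; c1; c2; c3; c4; c5; c6; c7] -> cyclic R c0 c1 c2 c3 c4 c5 c6 c7 ->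
    let E := circ_edge (octagon c0 c1 c2 c3 c4 c5 c6 c7) in
    E u v -> E v w -> u <> w -> v = c1 -> R u v w).
  { clear c0 c1 c2 c3 c4 c5 c6 c7.
    intros c0 c1 c2 c3 c4 c5 c6 c7 HN HR E E0 E1 n ->.
    apply octagon_edge_sym in E0.
    destruct HR as [[HR _] _].
    destruct (octagon_next _ _ _ _ _ _ _ _ _ HN E0) as [-> | ->];
    destruct (octagon_next _ _ _ _ _ _ _ _ _ HN E1) as [-> | ->]; try congruence; auto. }
  assert (rot : forall n c0 c1 c2 c3 c4 c5 c6 c7,
    NoDup [c0; c1; c2; c3; c4; c5; c6; c7] -> cyclic R c0 c1 c2 c3 c4 c5 c6 c7 ->
    let E := circ_edge (octagon c0 c1 c2 c3 c4 c5 c6 c7) in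
    E u v -> E v w -> u <> w ->
    n < 8 -> v = nth n [c1; c2; c3; c4; c5; c6; c7; c0] v -> R u v w).
  { induction n as [|n IH]; intros d0 d1 d2 d3 d4 d5 d6 d7 HN HR E E0 E1 n1 Hn Hv.
    - eapply at1; eauto.
    - apply (IH d1 d2 d3 d4 d5 d6 d7 d0); auto using NoDup_rot, octagon_rot; try lia.
      + unfold cyclic in *; tauto.
      + do 7 (destruct n as [|n]; [exact Hv|]); lia. }
  intros HN HR E E0 E1 n1.
  pose proof E1 as H; apply octagon_edge in H.
  assert (H' : v = c1 \/ v = c2 \/ v = c3 \/ v = c4 \/ v = c5 \/ v = c6 \/ v = c7 \/ v = c0)
    by tauto.
  repeat (destruct H' as [H'|H']).
  1-8: [> apply (rot 0 c0 c1 c2 c3 c4 c5 c6 c7) | apply (rot 1 c0 c1 c2 c3 c4 c5 c6 c7)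
   | apply (rot 2 c0 c1 c2 c3 c4 c5 c6 c7) | apply (rot 3 c0 c1 c2 c3 c4 c5 c6 c7)
   | apply (rot 4 c0 c1 c2 c3 c4 c5 c6 c7) | apply (rot 5 c0 c1 c2 c3 c4 c5 c6 c7)
   | apply (rot 6 c0 c1 c2 c3 c4 c5 c6 c7) | apply (rot 7 c0 c1 c2 c3 c4 c5 c6 c7)];
   auto; lia.
Qed.

End Octagons.

(** * Incidence axioms *)

Section Incidence.
Context {V : Type} (adj : V -> V -> Prop) (opp : V -> V -> V -> Prop) (pt : V -> Prop).

(* [gq_linear] and [gq_triangle] are (VP2) for k = 2 and k = 3, and [gq_octagon] is
   (VP3); by reversal it is enough to consider paths starting at a point. *)
Record green_quadrangle : Prop := {
  gq_sym : forall x y, adj x y -> adj y x;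
  gq_type : forall x y, adj x y -> (pt x <-> ~ pt y);
  gq_opp : forall v, opp_rel_at adj opp v;
  gq_green : green adj opp pt;
  gq_plump : kplump adj opp 2;
  gq_connected : connected adj;
  gq_linear : forall a b x y, pt a -> pt b ->
    adj a x -> adj b x -> adj a y -> adj b y -> a <> b -> x = y;
  gq_triangle : forall a x b x' b' y, pt a ->
    adj a x -> adj b x -> a <> b -> opp b x y ->
    adj a x' -> adj b' x' -> a <> b' -> opp b' x' y -> b = b';
  gq_octagon : forall a x b y c z, pt a ->
    adj a x -> adj b x -> a <> b -> opp b x y -> adj c y -> b <> c -> opp c y z ->
    exists e w, adj e z /\ adj e w /\ adj a w /\ e <> c /\ e <> a /\
      opp e z w /\ opp a w x }.

Lemma opp_adj v x y : (forall v, opp_rel_at adj opp v) ->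
  opp v x y -> adj v x /\ adj v y /\ opp v y x /\ x <> y.
Proof.
  intros H Hxy; destruct (H v) as [H1 [H2 H3]].
  destruct (H1 _ _ Hxy); repeat split; auto.
  intros ->; exact (H3 _ Hxy).
Qed.

(** A closed path may turn back at its base vertex and may repeat vertices. (VP2) excludes both, so
    the circuit of (VP3) is a genuine octagon and the given path is an arc of it; the two remaining
    vertices are [e] and [w]. *)
Lemma green_quadrangle_of_veldkamp :
  veldkamp_quadrangle adj opp pt -> green adj opp pt -> green_quadrangle.
Proof.
  intros [[_ [[[Hsym Hirr] Hloc] [[Hcon _] [VP2 VP3]]]] Htype] Hgreen.
  assert (Hopp : forall v, opp_rel_at adj opp v) by (intros v; apply Hloc).
  assert (toL : forall x y, adj x y -> pt x -> ~ pt y) by (intros x y A; apply Htype in A; tauto).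
  assert (toP : forall x y, adj x y -> ~ pt x -> pt y).
  { intros x y A; apply Htype in A; intros; apply NNPP; tauto. }
  assert (osym : forall v x y, opp v x y -> opp v y x).
  { intros v x y H; apply (opp_adj v x y Hopp H). }
  assert (Hgr : forall a x b, pt a -> adj a x -> adj b x -> a <> b -> opp x a b).
  { intros a x b pa ax bx n; apply Hgreen; auto. apply Htype in ax; tauto. }
  assert (Hlin : forall a b x y, pt a ->
    adj a x -> adj b x -> adj a y -> adj b y -> a <> b -> x = y).
  { intros a b x y pa ax bx ay by' n.
    assert (E : [a; y; b] = [a; x; b]); [|congruence].
    apply (VP2 2 ltac:(lia) [a; x; b] a b); unfold spath, straight, between;
      simpl; auto 20. }
  assert (Htri : forall a x b x' b' y, pt a ->
    adj a x -> adj b x -> a <> b -> opp b x y ->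
    adj a x' -> adj b' x' -> a <> b' -> opp b' x' y -> b = b').
  { intros a x b x' b' y pa ax bx n o ax' bx' n' o'.
    destruct (opp_adj _ _ _ Hopp o) as [? [? [? ?]]].
    destruct (opp_adj _ _ _ Hopp o') as [? [? [? ?]]].
    assert (E : [a; x'; b'; y] = [a; x; b; y]); [|congruence].
    apply (VP2 3 ltac:(lia) [a; x; b; y] a y); unfold spath, straight, between;
      simpl; auto 20. }
  split; auto.
  - intros v; apply Hloc.
  - intros a b x y pa _; apply (Hlin a b x y pa).
  - intros a x b y c z pa ax bx n1 o1 cy n2 o2.
    destruct (opp_adj _ _ _ Hopp o1) as [_ [b_y [_ n3]]].
    destruct (opp_adj _ _ _ Hopp o2) as [_ [cz [_ n4]]].
    assert (pb : pt b) by eauto.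
    destruct (VP3 [a; x; b; y; c; z]) as [c' [[[Hc Hlen] [_ [v0 [Hhd Hlast]]]] [Hstr Hin]]].
    { unfold spath; simpl; auto 20. }
    { unfold straight; simpl; auto 20. }
    destruct c' as [|c0 [|c1 [|c2 [|c3 [|c4 [|c5 [|c6 [|c7 [|c8 [|? ?]]]]]]]]]];
      try discriminate Hlen.
    simpl in Hhd; injection Hhd as ->; simpl in Hlast; subst c8.
    change [v0; c1; c2; c3; c4; c5; c6; c7; v0] with (octagon v0 c1 c2 c3 c4 c5 c6 c7) in *.
    rename v0 into c0.
    assert (Hopp3 : forall u v w, is_path adj [u; v; w] ->
      circ_edge (octagon c0 c1 c2 c3 c4 c5 c6 c7) u v ->
      circ_edge (octagon c0 c1 c2 c3 c4 c5 c6 c7) v w -> opp v u w).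
    { intros u v w P E1 E2. apply (Hstr [u; v; w]); auto.
      split; [|simpl; auto].
      apply octagon_edge_In in E1 as [? ?], E2 as [? ?].
      intros s [<-|[<-|[<-|[]]]]; auto. }
    simpl in Hc.
    assert (A07 : adj c7 c0) by tauto.
    (* Such a square would have two distinct points on two distinct lines. *)
    assert (square : forall c0 c1 c2 c3, adj c0 c1 -> adj c1 c2 -> adj c2 c3 -> adj c3 c0 ->
      c0 <> c2 -> c1 <> c3 -> False).
    { intros d0 d1 d2 d3 A0 A1 A2 A3 m1 m2.
      destruct (classic (pt d0)) as [p0|p0].
      - apply m2; apply (Hlin d0 d2); auto.
      - apply m1; apply (Hlin d1 d3); auto.
        pose proof (Htype _ _ A0); tauto. }
    assert (m17 : c1 <> c7).
    { (* Otherwise c1, ..., c6 is a straight hexagon. *)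
      intros <-.
      assert (m26 : c2 <> c6).
      { intros <-; apply (square c2 c3 c4 c5); tauto. }
      assert (E : [c1; c6; c5; c4] = [c1; c2; c3; c4]); [|congruence].
      assert (X1 : opp c2 c1 c3) by (apply Hopp3; [simpl; intuition| |]; rewrite octagon_edge; tauto).
      assert (X2 : opp c3 c2 c4) by (apply Hopp3; [simpl; intuition| |]; rewrite octagon_edge; tauto).
      assert (X3 : opp c6 c5 c1) by (apply Hopp3; [simpl; intuition| |]; rewrite octagon_edge; tauto).
      assert (X4 : opp c5 c4 c6) by (apply Hopp3; [simpl; intuition| |]; rewrite octagon_edge; tauto).
      apply (VP2 3 ltac:(lia) [c1; c2; c3; c4] c1 c4); unfold spath, straight, between;
        simpl; intuition. }
    assert (HN : NoDup [c0; c1; c2; c3; c4; c5; c6; c7]).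
    { assert (m04 : c0 <> c4) by (intros <-; apply (square c0 c1 c2 c3); tauto).
      assert (m15 : c1 <> c5) by (intros <-; apply (square c1 c2 c3 c4); tauto).
      assert (m26 : c2 <> c6) by (intros <-; apply (square c2 c3 c4 c5); tauto).
      assert (m37 : c3 <> c7) by (intros <-; apply (square c3 c4 c5 c6); tauto).
      assert (m06 : c0 <> c6) by (intros E; symmetry in E; tauto).
      destruct Hc as [? [[? [[? [[? [[? [[? [[? _] ?]] ?]] ?]] ?]] ?]] ?]].
      destruct (classic (pt c0)) as [P0|P0].
      - assert (P1 : ~ pt c1) by (eapply toL; eassumption). assert (P2 : pt c2) by eauto.
        assert (P3 : ~ pt c3) by (eapply toL; eassumption). assert (P4 : pt c4) by eauto.
        assert (P5 : ~ pt c5) by (eapply toL; eassumption). assert (P6 : pt c6) by eauto.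
        assert (P7 : ~ pt c7) by (eapply toL; eassumption).
        apply (octagon_NoDup pt); auto 10.
      - assert (P1 : pt c1) by eauto. assert (P2 : ~ pt c2) by (eapply toL; eassumption).
        assert (P3 : pt c3) by eauto. assert (P4 : ~ pt c4) by (eapply toL; eassumption).
        assert (P5 : pt c5) by eauto. assert (P6 : ~ pt c6) by (eapply toL; eassumption).
        assert (P7 : pt c7) by eauto.
        apply (octagon_NoDup (fun v => ~ pt v)); auto 10. }
    destruct Hin as [_ Hin]; simpl in Hin.
    destruct (octagon_completion (fun u v w => adj u v /\ adj v w /\ opp v u w) c0 c1 c2 c3 c4 c5 c6 c7 a x b y c z)
      as [e [w HR]]; try tauto.
    + intros u v w [? [? ?]]; auto.
    + assert (HR : forall u v w, adj u v -> adj v w -> u <> w ->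
        circ_edge (octagon c0 c1 c2 c3 c4 c5 c6 c7) u v ->
        circ_edge (octagon c0 c1 c2 c3 c4 c5 c6 c7) v w ->
        adj u v /\ adj v w /\ opp v u w).
      { intros u v w A1 A2 n E1 E2; repeat split; auto; apply Hopp3; simpl; auto. }
      assert (m06 : c0 <> c6) by (intros E; symmetry in E; tauto).
      assert (m71 : c7 <> c1) by auto.
      refine (conj (conj _ (conj _ (conj _ _))) (conj _ (conj _ (conj _ _))));
        (apply HR; [tauto|tauto|intuition congruence| |]; rewrite octagon_edge; tauto).
    + exists e, w; unfold cyclic in HR.
      destruct HR as [[_ [_ [_ [? [? H1]]]]] [[? [? H2]] [[? [? H3]] [[? [? H4]] [? [? H5]]]]]].
      pose proof (opp_adj _ _ _ Hopp H2); pose proof (opp_adj _ _ _ Hopp H4).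
      intuition.
Qed.

(** Meant for the quotient, where only the incidence axioms are verified directly. *)
Lemma veldkamp_of_green_quadrangle :
  green_quadrangle -> veldkamp_quadrangle adj opp pt.
Proof.
  intros [Hsym Htype Hopp Hgreen Hpl Hcon Hlin Htri Hoct].
  assert (Hirr : forall x, ~ adj x x) by (intros x A; pose proof (Htype _ _ A); tauto).
  assert (toL : forall x y, adj x y -> pt x -> ~ pt y) by (intros x y A; apply Htype in A; tauto).
  assert (toP : forall x y, adj x y -> ~ pt x -> pt y).
  { intros x y A; apply Htype in A; intros; apply NNPP; tauto. }
  assert (osym : forall v x y, opp v x y -> opp v y x).
  { intros v x y H; apply (opp_adj v x y Hopp H). }
  split; [|exact Htype].
  split; [lia|]; split; [split; [split; auto|intros v; split; auto]|].
  split; [split; auto|split].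
  - exists (fun v => if excluded_middle_informative (pt v) then true else false).
    intros x y A; pose proof (Htype _ _ A).
    destruct (excluded_middle_informative (pt x)), (excluded_middle_informative (pt y));
      tauto || discriminate.
  - assert (Hlin' : forall x y a b, ~ pt x ->
      adj a x -> adj b x -> adj a y -> adj b y -> x <> y -> a = b).
    { intros x y a b px ax bx ay by' n; apply NNPP; intros m; apply n.
      pose proof (Htype _ _ ax); pose proof (Htype _ _ bx).
      apply (Hlin a b); tauto. }
    intros k Hk p a b [Hp Hlen] Hstr [Hhd Hlast] q Hq [Hhd' Hlast'] Hlen'.
    destruct Hstr as [_ Hstr], Hq as [Hq Hstr'].
    destruct p as [|p0 [|p1 [|p2 [|p3 [|? ?]]]]]; simpl in Hlen; try lia;
    destruct q as [|q0 [|q1 [|q2 [|q3 [|? ?]]]]]; simpl in Hlen'; try lia;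
    simpl in *; try discriminate Hhd; try discriminate Hhd';
    injection Hhd as Hhd; injection Hhd' as Hhd'; subst p0 q0;
    match type of Hlast with ?z = b => subst z end;
    try match type of Hlast' with a = b => fail 1 | ?z = b => subst z end;
    repeat match goal with H : _ /\ _ |- _ => destruct H end;
    try (exfalso; congruence); try (exfalso; subst; eapply Hirr; eassumption); auto.
    all: destruct (classic (pt a)) as [pa|pa];
      repeat match goal with
      | A : adj ?u ?v, P : pt ?u |- _ =>
          match goal with _ : ~ pt v |- _ => fail 1 | _ => pose proof (toL _ _ A P) end
      | A : adj ?u ?v, P : ~ pt ?u |- _ =>
          match goal with _ : pt v |- _ => fail 1 | _ => pose proof (toP _ _ A P) end
      end; try contradiction; try (subst; contradiction).
    (* Parity of lengths leaves three situations, each for [a] a point and for [a] a line: two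
       2-paths, a 3-path against an edge, and two 3-paths. *)
    + rewrite (Hlin a b p1 q1); auto.
    + rewrite (Hlin' a b p1 q1); auto.
    + exfalso; assert (p1 = b) by (apply (Hlin a p2); auto); congruence.
    + exfalso; assert (p1 = b) by (apply (Hlin' a p2); auto); congruence.
    + assert (p2 = q2) by (apply (Htri a p1 p2 q1 q2 b); auto); subst q2.
      rewrite (Hlin a p2 p1 q1); auto.
    + assert (p1 = q1) by (apply (Htri b p2 p1 q2 q1 a); auto); subst q1.
      rewrite (Hlin b p1 p2 q2); auto.
  - (* Both types of 5-paths reduce, by reversal, to those starting at a point. *)
    assert (Hcirc : forall a x b y c z, pt a -> is_path adj [a; x; b; y; c; z] ->
      opp b x y -> opp c y z -> exists e w,
        let o := octagon a x b y c z e w in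
        closed_path adj 8 o /\ straight_circ adj opp o).
    { intros a x b y c z pa [ax [[xb [[b_y [[yc [[cz _] n4]] n3]] n2]] n1]] o1 o2.
      assert (tx : ~ pt x) by (eapply toL; eassumption). assert (tb : pt b) by eauto.
      assert (ty : ~ pt y) by (eapply toL; eassumption). assert (tc : pt c) by eauto.
      assert (tz : ~ pt z) by (eapply toL; eassumption).
      destruct (Hoct a x b y c z) as [e [w [ez [ew [aw [n5 [n6 [o3 o4]]]]]]]]; auto.
      exists e, w.
      destruct (opp_adj _ _ _ Hopp o3) as [_ [_ [_ m1]]].
      destruct (opp_adj _ _ _ Hopp o4) as [_ [_ [o4' m2]]].
      assert (tw : ~ pt w) by (eapply toL; eassumption). assert (te : pt e) by eauto.
      assert (m3 : b <> e).
      { intros <-; apply n4; apply (Hlin b c); auto. }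
      assert (m4 : a <> c).
      { intros <-; apply n2; apply (Hlin a b); auto. }
      assert (m5 : x <> z).
      { intros <-; apply n4; symmetry; apply (Hlin b c); auto. }
      assert (m6 : y <> w).
      { intros <-; apply n2; apply (Hlin a b); auto. }
      split.
      - split; [split; [simpl; auto 30|reflexivity]|].
        split; [lia|exists a; split; reflexivity].
      - assert (trip : forall u v t, adj u v -> adj v t -> u <> t ->
          circ_edge (octagon a x b y c z e w) u v ->
          circ_edge (octagon a x b y c z e w) v t -> opp v u t).
        { intros u v t A1 A2 n E1 E2.
          apply (octagon_triple (fun u v w => opp v u w) a x b y c z e w); auto.
          - apply (octagon_NoDup pt); auto 10.
          - assert (gr : forall p l q, adj p l -> adj l q -> p <> q -> pt p -> opp l p q).
            { intros p l q B1 B2 m pp; apply Hgreen; eauto. }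
            repeat apply conj; auto. }
        intros p Pp [_ Ep]; split; [exact Pp|].
        induction p as [|u [|v [|t p]] IH]; simpl; auto.
        simpl in Pp, Ep, IH; split; [apply trip; tauto|apply IH; tauto]. }
    intros p [Hp Hlen] [_ Hstr].
    destruct p as [|a [|x [|b [|y [|c [|z [|? ?]]]]]]]; simpl in Hlen; try lia.
    destruct (classic (pt a)) as [pa|pa].
    + destruct (Hcirc a x b y c z) as [e [w [C1 C2]]]; auto; try (simpl in Hstr; tauto).
      exists (octagon a x b y c z e w); split; [exact C1|split; [exact C2|]].
      split; [simpl; tauto|].
      cbn [edges_in]; rewrite !octagon_edge; tauto.
    + simpl in Hp, Hstr.
      destruct (Hcirc z c y b x a) as [e [w [C1 C2]]]; auto.
      { destruct Hp as [? [[? [[? [[? [[? _] ?]] ?]] ?]] ?]].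
        assert (pt x) by eauto. assert (~ pt b) by (eapply toL; eassumption).
        assert (pt y) by eauto. assert (~ pt c) by (eapply toL; eassumption). eauto. }
      { simpl; destruct Hp as [? [[? [[? [[? [[? _] ?]] ?]] ?]] ?]]; auto 30. }
      { apply osym; tauto. } { apply osym; tauto. }
      exists (octagon z c y b x a e w); split; [exact C1|split; [exact C2|]].
      split; [simpl; tauto|].
      cbn [edges_in]; rewrite !octagon_edge; tauto.
Qed.

End Incidence.

(** * Near and opposite points *)

Section Geometry.
Context {V : Type} (adj : V -> V -> Prop) (opp : V -> V -> V -> Prop) (pt : V -> Prop).
Context (GQ : green_quadrangle adj opp pt).

Definition inc (a x : V) : Prop := pt a /\ adj a x.

Lemma inc_line a x : inc a x -> ~ pt x.
Proof. intros [pa ax]; apply (gq_type _ _ _ GQ) in ax; tauto. Qed.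

Lemma inc_of_line a x : ~ pt x -> adj x a -> inc a x.
Proof.
  intros px A; split; [|apply (gq_sym _ _ _ GQ); auto].
  pose proof (gq_type _ _ _ GQ _ _ A); apply NNPP; tauto.
Qed.

Lemma line_unique a b x y :
  inc a x -> inc b x -> inc a y -> inc b y -> a <> b -> x = y.
Proof. intros [? ?] [? ?] [? ?] [? ?] n; apply (gq_linear _ _ _ GQ a b); auto. Qed.

Lemma opp_inc b x y : pt b -> opp b x y -> inc b x /\ inc b y /\ opp b y x /\ x <> y.
Proof.
  intros pb o; destruct (opp_adj _ _ _ _ _ (gq_opp _ _ _ GQ) o) as [? [? [? ?]]].
  unfold inc; auto.
Qed.

Lemma opp_irrefl b x : ~ opp b x x.
Proof. apply (gq_opp _ _ _ GQ). Qed.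

Lemma opp_sym b x y : opp b x y -> opp b y x.
Proof. apply (gq_opp _ _ _ GQ). Qed.

Lemma third_point p q x : inc p x -> inc q x -> exists r, inc r x /\ r <> p /\ r <> q.
Proof.
  intros ip iq; pose proof (inc_line _ _ ip) as lx.
  destruct (gq_plump _ _ _ GQ x [p; q]) as [r [xr Hr]]; [simpl; lia| |].
  - intros s [<-|[<-|[]]]; apply (gq_sym _ _ _ GQ); [apply ip|apply iq].
  - exists r; split; [apply inc_of_line; auto|].
    split; intros ->; [apply (opp_irrefl x p)|apply (opp_irrefl x q)];
      apply Hr; simpl; auto.
Qed.

Lemma common_opp b x y : inc b x -> inc b y -> exists m, opp b m x /\ opp b m y.
Proof.
  intros [? bx] [_ b_y].
  destruct (gq_plump _ _ _ GQ b [x; y]) as [m [_ Hm]]; [simpl; lia| |].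
  - intros s [<-|[<-|[]]]; auto.
  - exists m; split; apply Hm; simpl; auto.
Qed.

Lemma line_through a : pt a -> exists x, inc a x.
Proof.
  intros pa; destruct (gq_plump _ _ _ GQ a []) as [x [ax _]]; [simpl; lia|intros s []|].
  exists x; split; auto.
Qed.

Lemma point_on x : ~ pt x -> exists a, inc a x.
Proof.
  intros px; destruct (gq_plump _ _ _ GQ x []) as [a [xa _]]; [simpl; lia|intros s []|].
  exists a; apply inc_of_line; auto.
Qed.

(** Opposition of points. A root is recorded with opposition at its middle point only, since at a
    line of a green quadrangle opposite means distinct. *)
Definition far (a c : V) : Prop :=
  exists x b y, inc a x /\ inc b x /\ inc b y /\ inc c y /\ a <> b /\ b <> c /\ opp b x y.

Definition near (a c : V) : Prop := ~ far a c.

Lemma far_intro a x b y c : inc a x -> inc b x -> inc b y -> inc c y ->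
  a <> b -> b <> c -> opp b x y -> far a c.
Proof. intros; exists x, b, y; auto 10. Qed.

Lemma far_sym a c : far a c -> far c a.
Proof.
  intros [x [b [y [? [? [? [? [? [? ?]]]]]]]]].
  apply (far_intro c y b x a); auto using opp_sym.
Qed.

Lemma near_sym a c : near a c -> near c a.
Proof. intros H F; apply H, far_sym, F. Qed.

(* An octagon through a root from [a] to [c] meets every line through [c]. *)
Lemma far_projection a c u : far a c -> inc c u ->
  exists d w, inc d u /\ inc d w /\ inc a w /\ opp d w u /\ d <> a /\ d <> c.
Proof.
  assert (key : forall x b y z, inc a x -> inc b x -> inc c y -> a <> b -> b <> c ->
    opp b x y -> opp c y z ->
    exists d w, inc d z /\ inc d w /\ inc a w /\ opp d w z /\ d <> a /\ d <> c).
  { intros x b y z ax bx cy n1 n2 o1 o2.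
    destruct (opp_inc _ _ _ (proj1 cy) o2) as [_ [cz _]].
    destruct (gq_octagon _ _ _ GQ a x b y c z) as [e [w [ez [ew [aw [n3 [n4 [o3 o4]]]]]]]];
      try apply ax; try apply bx; try apply cy; auto.
    assert (lz := inc_line _ _ cz).
    assert (iz : inc e z) by (apply inc_of_line; auto; apply (gq_sym _ _ _ GQ); auto).
    assert (iw : inc e w) by (split; [apply iz|auto]).
    assert (jw : inc a w) by (split; [apply ax|auto]).
    exists e, w; auto 10 using opp_sym. }
  intros [x [b [y [ax [bx [b_y [cy [n1 [n2 o]]]]]]]]] cu.
  (* The octagon reaches only lines opposite [y] at [c]; a line [m] opposite both [y] and [u] leads
     to an arbitrary [u] in two steps. *)
  destruct (common_opp c y u cy cu) as [m [o1 o2]].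
  destruct (opp_inc _ _ _ (proj1 cy) o1) as [cm _].
  destruct (key x b y m) as [d [w [dm [dw [aw [o3 [n3 n4]]]]]]]; auto using opp_sym.
  apply (key w d m u); auto.
Qed.

(** Otherwise the line joining [a] to its projection onto [x] would be [x] itself, and [x] would be
    opposite to itself. *)
Lemma collinear_near a c x : inc a x -> inc c x -> near a c.
Proof.
  intros ax cx F; destruct (far_projection a c x F cx) as [d [w [dx [dw [aw [o [n1 n2]]]]]]].
  assert (x = w) as <- by (apply (line_unique a d); auto).
  exact (opp_irrefl _ _ o).
Qed.

Lemma near_refl a : pt a -> near a a.
Proof. intros pa; destruct (line_through a pa) as [x ax]; eapply collinear_near; eauto. Qed.

(* The one-or-all axiom of polar spaces for the relation [near]. *)
Lemma one_near a c u : far a c -> inc c u ->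
  exists d w, inc d u /\ inc d w /\ inc a w /\ opp d w u /\ d <> a /\ d <> c /\
    near a d /\ forall e, inc e u -> near a e -> e = d.
Proof.
  intros F cu; destruct (far_projection a c u F cu) as [d [w [dx [dw [aw [o [n1 n2]]]]]]].
  exists d, w; repeat (split; [solve [auto]|]).
  split; [eapply collinear_near; eauto|].
  intros e eu N; apply NNPP; intros m; apply N; apply (far_intro a w d u e); auto.
Qed.

Lemma near_line a b c u : inc b u -> inc c u -> b <> c -> near a b -> near a c ->
  forall e, inc e u -> near a e.
Proof.
  intros bu cu n Nb Nc e eu F.
  destruct (one_near a e u F eu) as [d [w [_ [_ [_ [_ [_ [_ [_ U]]]]]]]]].
  apply n; rewrite (U b), (U c); auto.
Qed.

Lemma far_line a b c e u : inc b u -> inc c u -> far a b -> near a c ->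
  inc e u -> e <> c -> far a e.
Proof.
  intros bu cu F N eu n; apply NNPP; intros Ne.
  exact (near_line a e c u eu cu n Ne N b bu F).
Qed.

(** On a line through [b] opposite [x], every point other than [b] is far from [a] but collinear
    with [b]. This separates distinct collinear points. *)
Lemma far_one_side a b x : inc a x -> inc b x -> a <> b ->
  exists z m, far a z /\ inc z m /\ inc b m /\ near b z.
Proof.
  intros ax bx n; destruct (common_opp b x x bx bx) as [m [o _]].
  destruct (opp_inc _ _ _ (proj1 bx) o) as [bm [_ [o' _]]].
  destruct (third_point b b m bm bm) as [z [zm [n1 _]]].
  exists z, m; split; [|split; [auto|split; [auto|eapply collinear_near; eauto]]].
  apply (far_intro a x b m z); auto.
Qed.

(** If [c'] is near [z], then it is the projection of [z] onto [l]. On a line through [z] opposite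
    the joining line, all points but [z] are far from [c'] and all but one are far from [a]; a third
    point serves. *)
Lemma common_far_step a c c' z l : pt a -> inc c l -> inc c' l -> far a z -> far c z ->
  exists f, far a f /\ far c' f.
Proof.
  intros pa cl cl' Fa Fc.
  destruct (classic (far c' z)) as [F|N]; [eauto|].
  destruct (one_near z c l (far_sym _ _ Fc) cl) as [d [w [dl [dw [zw [o [n1 [n2 [_ U]]]]]]]]].
  assert (c' = d) as <- by (apply U; auto; apply near_sym; auto).
  destruct (common_opp z w w zw zw) as [n [o1 _]].
  destruct (opp_inc _ _ _ (proj1 zw) o1) as [zn [_ [o2 _]]].
  destruct (one_near a z n Fa zn) as [d2 [_ [d2n [_ [_ [_ [_ [_ [N2 _]]]]]]]]].
  destruct (third_point z d2 n zn d2n) as [f [fn [m1 m2]]].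
  exists f; split; [apply (far_line a z d2 f n); auto|].
  apply (far_intro c' w z n f); auto.
Qed.

(** The invariant carried along a walk from [a], which by connectedness reaches every point. *)
Definition meet_far (a v : V) : Prop :=
  (pt v -> exists z, far a z /\ far v z) /\
  (~ pt v -> exists d z, inc d v /\ far a z /\ far d z).

Lemma meet_far_step a u v : pt a -> adj u v -> meet_far a u -> meet_far a v.
Proof.
  intros pa A [Hp Hl]; pose proof (gq_type _ _ _ GQ _ _ A) as T; split; intros tv.
  - assert (iv : inc v u) by (apply inc_of_line; tauto).
    destruct Hl as [d [z [du [F1 F2]]]]; [tauto|].
    apply (common_far_step a d v z u); auto.
  - assert (pu : pt u) by tauto.
    destruct (Hp pu) as [z [F1 F2]]; exists u, z; split; [split|]; auto.
Qed.

Lemma common_far a c : pt a -> pt c -> exists z, far a z /\ far c z.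
Proof.
  intros pa pc; destruct (gq_connected _ _ _ GQ a c) as [w [Hw [Hhd Hlast]]].
  assert (H0 : meet_far a a).
  { split; [intros _|tauto].
    destruct (line_through a pa) as [x ax].
    destruct (third_point a a x ax ax) as [b [bx [n _]]].
    destruct (far_one_side a b x) as [z [_ [F _]]]; eauto. }
  assert (H : forall w u, is_walk adj w -> hd_error w = Some u -> meet_far a u ->
    meet_far a (last w a)).
  { clear w Hw Hhd Hlast; induction w as [|u w IH]; intros v Hw Hhd Hv; [contradiction|].
    injection Hhd as ->; destruct w as [|u w]; [exact Hv|].
    destruct Hw as [A Hw]; apply (IH u); auto.
    apply (meet_far_step a v); auto. }
  specialize (H w a Hw Hhd H0); rewrite Hlast in H; apply H; auto.
Qed.

(** * Points with the same opposites, and weeds *)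

Definition collinear (a c : V) : Prop := exists l, inc a l /\ inc c l.

(** Nothing is far from a line, so without the [pt] clauses any two lines would be equivalent. *)
Definition equiv (a b : V) : Prop := pt a /\ pt b /\ forall z, far a z <-> far b z.

Lemma equiv_refl a : pt a -> equiv a a.
Proof. split; [auto|split; [auto|tauto]]. Qed.

Lemma equiv_sym a b : equiv a b -> equiv b a.
Proof. intros [? [? H]]; split; [auto|split; [auto|]]; intros z; symmetry; auto. Qed.

Lemma equiv_trans a b c : equiv a b -> equiv b c -> equiv a c.
Proof.
  intros [? [? H]] [_ [? H']]; split; [auto|split; [auto|]].
  intros z; rewrite H; auto.
Qed.

Lemma equiv_near a b z : equiv a b -> near a z -> near b z.
Proof. intros [_ [_ H]] N F; apply N, H, F. Qed.

Lemma equiv_near_self a b : equiv a b -> near a b.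
Proof.
  intros E; apply (equiv_near b a b); [apply equiv_sym; auto|].
  apply near_refl, E.
Qed.

(** If some [e] on [y] were far from [a], then [c] would be the projection of [a] onto [y], hence
    collinear with [a]. *)
Lemma near_line_of_noncollinear a c y e : near a c -> ~ collinear a c ->
  inc c y -> inc e y -> near a e.
Proof.
  intros N n cy ey F; destruct (one_near a e y F ey) as [d [w [_ [dw [aw [_ [_ [_ [_ U]]]]]]]]].
  apply n; exists w; split; auto; rewrite (U c); auto.
Qed.

Lemma collinear_sym a c : collinear a c -> collinear c a.
Proof. intros [l [? ?]]; exists l; auto. Qed.

(** The point [e] is the projection of [a] onto [g], so it lies on a line through [a], and all
    points of that line are near [c]. *)
Lemma near_projection a c u g e : near a c -> ~ collinear a c ->
  far u a -> inc u g -> inc e g -> near a e -> near c e.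
Proof.
  intros N n F ug eg Ne.
  destruct (one_near a u g (far_sym _ _ F) ug) as [d [w [_ [dw [aw [_ [_ [_ [_ U]]]]]]]]].
  assert (e = d) as -> by auto.
  apply (near_line_of_noncollinear c a w); auto using near_sym, collinear_sym.
Qed.

(** Take for [d] the projection of [u] onto [x], and for [v] the line joining it to [u]. As [d] is
    near [c], it is also the projection of [c] onto [v], which makes it collinear with [c]. *)
Lemma noncollinear_midpoint a c u x : near a c -> ~ collinear a c ->
  far u a -> far u c -> inc a x ->
  exists d v w, inc d x /\ inc d v /\ inc u v /\ inc d w /\ inc c w /\
    near u d /\ d <> a /\ d <> u /\ opp d v x.
Proof.
  intros N n Fa Fc ax.
  destruct (one_near u a x Fa ax) as [d [v [dx [dv [uv [o [n1 [n2 [Nd U]]]]]]]]].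
  assert (Nad : near a d) by (eapply collinear_near; eauto).
  assert (Ncd : near c d) by (apply (near_projection a c u v); auto).
  destruct (one_near c u v (far_sym _ _ Fc) uv) as [d' [w [_ [dw [cw [_ [_ [_ [_ U']]]]]]]]].
  assert (d = d') as <- by auto.
  exists d, v, w; auto 10.
Qed.

(** Suppose [z] is near [c]. Then [z] and [c] are not collinear, so [z] is near the midpoint [d] and
    far from any third point [p] of [x]. Once [p] is known to be collinear with [c], the projection
    of [z] onto their line is [c], so [z] and [c] are collinear after all. *)
Lemma far_of_noncollinear a c z : pt a -> pt c ->
  near a c -> ~ collinear a c -> far a z -> far c z.
Proof.
  intros pa pc N n Fz; apply NNPP; intros Nz; apply near_sym in Nz.
  destruct (common_far a c pa pc) as [u [Fa Fc]].
  pose proof (far_sym _ _ Fa) as Fa'; pose proof (far_sym _ _ Fc) as Fc'.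
  destruct (line_through a pa) as [x ax].
  destruct (noncollinear_midpoint a c u x) as
    [d [v [w [dx [dv [uv [dw [cw [Nud [n1 [n2 o]]]]]]]]]]]; auto.
  assert (nzc : ~ collinear z c).
  { intros [l [zl cl]]; apply (near_line_of_noncollinear a c l z N n cl zl Fz). }
  assert (Nzd : near z d) by (apply (near_line_of_noncollinear z c w); auto).
  destruct (third_point a d x ax dx) as [p [px [n3 n4]]].
  assert (Ncp : near c p).
  { apply (near_line_of_noncollinear c a x); auto using near_sym, collinear_sym. }
  assert (pcol : collinear p c).
  { (* Otherwise a, c and p have the same projection onto a line g opposite
       uv at u, and this projection is near d as well. *)
    apply NNPP; intros np.
    destruct (common_opp u v v uv uv) as [g [og _]].
    destruct (opp_inc _ _ _ (proj1 uv) og) as [ug [_ [og' _]]].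
    destruct (one_near a u g Fa ug) as [e [_ [eg [_ [_ [_ [_ [n5 [Nae _]]]]]]]]].
    assert (Nce : near c e) by (apply (near_projection a c u g); auto).
    assert (Fup : far u p) by (apply (far_line u a d p x); auto).
    destruct (one_near p u g (far_sym _ _ Fup) ug) as [e' [_ [eg' [_ [_ [_ [_ [_ [Npe _]]]]]]]]].
    assert (Nce' : near c e') by (apply (near_projection p c u g); auto using near_sym).
    destruct (one_near c u g Fc ug) as [e'' [_ [_ [_ [_ [_ [_ [_ [_ U]]]]]]]]].
    assert (e = e') as <- by (rewrite (U e), (U e'); auto).
    apply (near_line e a p x ax px) with (e := d); auto using near_sym.
    apply far_sym, (far_intro d v u g e); auto. }
  destruct pcol as [l [pl cl]].
  assert (Fzp : far z p) by (apply (far_line z a d p x); auto using far_sym).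
  destruct (one_near z p l Fzp pl) as [q [w' [_ [qw [zw [_ [_ [_ [_ U]]]]]]]]].
  apply nzc; exists w'; split; auto; rewrite (U c); auto.
Qed.

Lemma equiv_of_noncollinear a c : pt a -> pt c -> near a c -> ~ collinear a c -> equiv a c.
Proof.
  intros pa pc N n; split; [auto|split; [auto|]]; intros z; split.
  - apply far_of_noncollinear; auto.
  - apply far_of_noncollinear; auto using near_sym, collinear_sym.
Qed.

Lemma collinear_equiv a b : collinear a b -> equiv a b -> a = b.
Proof.
  intros [x [ax bx]] [_ [_ E]]; apply NNPP; intros n.
  destruct (far_one_side a b x ax bx n) as [z [m [F [_ [_ N]]]]].
  apply N, E, F.
Qed.

Lemma near_cases a b : pt a -> pt b -> near a b -> equiv a b \/ collinear a b.
Proof.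
  intros pa pb N; destruct (classic (collinear a b)) as [C|C]; auto.
  left; apply equiv_of_noncollinear; auto.
Qed.

(** Opposition at the two lines is automatic, so straightness can fail only at [b]; walks between
    points have even length, so distance 4 amounts to not being collinear. *)
Lemma weed_inc a x b y c : weed adj opp pt a x b y c <->
  (inc a x /\ inc b x /\ inc b y /\ inc c y /\ a <> b /\ b <> c) /\
  ~ opp b x y /\ ~ collinear a c.
Proof.
  assert (adj_sym := gq_sym _ _ _ GQ); assert (type := gq_type _ _ _ GQ).
  split.
  - intros [P [S [pa [pb [pc [_ D]]]]]]; simpl in P.
    assert (ax : inc a x) by (split; [auto|tauto]).
    assert (bx : inc b x) by (split; [auto|apply adj_sym; tauto]).
    assert (b_y : inc b y) by (split; [auto|tauto]).
    assert (cy : inc c y) by (split; [auto|apply adj_sym; tauto]).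
    split; [tauto|split].
    + intros o; apply S; split; [exact P|]; simpl.
      assert (lx := inc_line _ _ ax); assert (ly := inc_line _ _ cy).
      split; [|split; [auto|split; [|auto]]].
      * apply (gq_green _ _ _ GQ); tauto || (apply adj_sym; tauto).
      * apply (gq_green _ _ _ GQ); tauto || (apply adj_sym; tauto).
    + intros [l [al cl]].
      assert (Hw : 4 <= 2); [|lia].
      apply (D [a; l; c]); [|split; reflexivity|reflexivity].
      destruct al, cl; simpl; auto.
  - intros [[ax [bx [b_y [cy [n1 n2]]]]] [no nc]].
    assert (n3 : x <> y).
    { intros <-; apply nc; exists x; auto. }
    assert (P : is_path adj [a; x; b; y; c]).
    { destruct ax, bx, b_y, cy; simpl; auto 20. }
    split; [exact P|].
    split; [intros [_ S]; simpl in S; tauto|].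
    split; [apply ax|split; [apply bx|split; [apply cy|]]].
    split.
    + exists [a; x; b; y; c]; split; [|split; [split|]; reflexivity].
      simpl in *; tauto.
    + intros w m Hw [Hhd Hlast] Hlen.
      destruct w as [|w0 [|w1 [|w2 [|w3 [|? ?]]]]]; simpl in *; try lia; try discriminate;
        injection Hhd as ->; subst; exfalso.
      * apply nc; exists x; auto.
      * destruct Hw as [A _]; apply type in A; destruct ax, cy; tauto.
      * destruct Hw as [A1 [A2 _]]; apply nc; exists w1; split; split;
          auto; [apply ax|apply cy].
      * destruct Hw as [A1 [A2 [A3 _]]]; apply type in A1, A2, A3; destruct ax, cy; tauto.
Qed.

(** If [a] and [c] were far, the projection of [c] onto [x] would be [b] with joining line [y], and
    the path would be straight at [b]. *)
Lemma weed_near a x b y c : weed adj opp pt a x b y c -> near a c.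
Proof.
  rewrite weed_inc; intros [[ax [bx [b_y [cy [n1 n2]]]]] [no nc]] F.
  destruct (one_near c a x (far_sym _ _ F) ax) as [d [w [_ [dw [cw [o [_ [_ [_ U]]]]]]]]].
  assert (b = d) as <-.
  { apply U; auto; apply (collinear_near c b y); auto. }
  assert (w = y) as -> by (apply (line_unique b c); auto).
  apply no, opp_sym, o.
Qed.

(** Distinct equivalent points are not collinear, and the midpoint of [noncollinear_midpoint] gives
    a path between them. It is a weed, for straightness at the midpoint would make the points
    far. *)
Lemma psim_equiv a b : pt a -> psim adj opp pt a b <-> equiv a b.
Proof.
  intros pa; split.
  - intros [<-|[x [m [y W]]]]; [apply equiv_refl; auto|].
    pose proof (weed_near _ _ _ _ _ W); apply weed_inc in W.
    apply equiv_of_noncollinear; auto; [apply W|tauto].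
  - intros E; destruct (classic (a = b)) as [->|n]; [left; auto|right].
    assert (nc : ~ collinear a b) by (intros C; apply n, collinear_equiv; auto).
    destruct E as [_ [pb E]].
    destruct (common_far a b pa pb) as [u [Fa Fb]].
    destruct (line_through a pa) as [x ax].
    assert (N : near a b).
    { intros F; apply E in F; exact (near_refl b pb F). }
    destruct (noncollinear_midpoint a b u x) as
      [d [v [w [dx [_ [_ [dw [bw [_ [n1 [_ _]]]]]]]]]]]; auto using far_sym.
    exists x, d, w; apply weed_inc.
    assert (n2 : d <> b) by (intros ->; apply nc; exists x; auto).
    split; [auto 10|split; [|auto]].
    intros o; apply N, (far_intro a x d w b); auto.
Qed.

(** * Traces of lines *)

(** Membership of the class of [p] in the trace of [x]; [p] itself need not lie on [x]. *)
Definition on (p x : V) : Prop := exists p', inc p' x /\ equiv p' p.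

Lemma inc_on p x : inc p x -> on p x.
Proof. intros i; exists p; split; [auto|apply equiv_refl, i]. Qed.

Lemma on_equiv p q x : on p x -> equiv p q -> on q x.
Proof. intros [p' [i E]] E'; exists p'; split; [auto|apply (equiv_trans p' p); auto]. Qed.

Lemma on_line p x : on p x -> ~ pt x.
Proof. intros [p' [i _]]; apply (inc_line _ _ i). Qed.

Lemma on_pt p x : on p x -> pt p.
Proof. intros [p' [_ [_ [H _]]]]; auto. Qed.

Lemma near_equiv a b c d : equiv a b -> equiv c d -> near a c -> near b d.
Proof.
  intros E E' N; apply (equiv_near a b d E), near_sym, (equiv_near c d a E'), near_sym, N.
Qed.

Lemma far_equiv a b c d : equiv a b -> equiv c d -> far a c -> far b d.
Proof.
  intros E E' F; apply NNPP; intros N; revert F; apply (near_equiv b a d c); auto using equiv_sym.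
Qed.

Lemma far_not_equiv a c z : far z a -> near z c -> ~ equiv a c.
Proof.
  intros F N [_ [_ E]]; apply N, far_sym, E, far_sym, F.
Qed.

Lemma on_near p q x : on p x -> on q x -> near p q.
Proof.
  intros [p' [i E]] [q' [i' E']]; apply (near_equiv p' p q' q E E').
  eapply collinear_near; eauto.
Qed.

Lemma near_line_on a b c u e : on b u -> on c u -> ~ equiv b c -> near a b -> near a c ->
  on e u -> near a e.
Proof.
  intros [b' [bu Eb]] [c' [cu Ec]] n Nb Nc [e' [eu Ee]].
  assert (n' : b' <> c').
  { intros <-; apply n, (equiv_trans b b'); auto using equiv_sym. }
  assert (N : forall q q', equiv q' q -> near a q -> near a q').
  { intros q q' E N; apply near_sym, (equiv_near q q'); auto using near_sym, equiv_sym. }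
  apply near_sym, (equiv_near e' e a Ee), near_sym.
  apply (near_line a b' c' u); eauto.
Qed.

Lemma far_line_on a b c e u : on b u -> on c u -> far a b -> near a c ->
  on e u -> ~ equiv e c -> far a e.
Proof.
  intros bu cu F N eu n; apply NNPP; intros Ne.
  exact (near_line_on a e c u b eu cu n Ne N bu F).
Qed.

Lemma one_near_on a c u : far a c -> on c u ->
  exists d w, inc d u /\ inc d w /\ inc a w /\ opp d w u /\ ~ equiv c d /\ ~ equiv a d /\
    forall e, on e u -> near a e -> equiv e d.
Proof.
  intros F [c' [cu Ec]].
  assert (F' : far a c').
  { apply (far_equiv a a c c'); auto using equiv_sym.
    apply equiv_refl; destruct F as [? [? [? [H _]]]]; apply H. }
  destruct (one_near a c' u F' cu) as [d [w [du [dw [aw [o [n1 [n2 [N U]]]]]]]]].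
  exists d, w; repeat (split; [solve [auto]|]); split; [|split].
  - apply (far_not_equiv c d a F N).
  - intros E; apply n1; symmetry; apply collinear_equiv; auto; exists w; auto.
  - intros e [e' [eu Ee]] Ne.
    rewrite <- (U e'); auto using equiv_sym.
    apply near_sym, (equiv_near e e'); auto using near_sym, equiv_sym.
Qed.

(* The argument of Buekenhout and Shult by which a nondegenerate polar space is
   a partial linear space. *)
Lemma on_of_double_perp p y : pt p -> ~ pt y ->
  (forall t, pt t -> (forall q, inc q y -> near t q) -> near t p) -> on p y.
Proof.
  intros pp ly H.
  destruct (point_on y ly) as [b b_y].
  destruct (classic (equiv b p)) as [E|nE]; [exists b; auto|].
  assert (Hp : forall q, inc q y -> near q p).
  { intros q qy; apply H; [apply qy|]; intros; eapply collinear_near; eauto. }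
  assert (Nbp : near b p) by auto.
  assert (pb : pt b) by apply b_y.
  destruct (near_cases b p pb pp Nbp) as [?|[x [bx px]]]; [contradiction|].
  assert (n : b <> p) by (intros ->; apply nE, equiv_refl; auto).
  (* The projection [q] onto [y] of a point [z] far from [b] and collinear with [p] will turn out to
     be equivalent to [p]. *)
  destruct (far_one_side b p x bx px n) as [z [m [Fz [zm [pm Npz]]]]].
  destruct (one_near z b y (far_sym _ _ Fz) b_y) as [q [_ [qy [_ [_ [_ [_ [nq [Nzq _]]]]]]]]].
  (* For a [w] far from [p] but near [q], let [s] be its projection onto [m] and [t] the projection
     of [b] onto the line [n'] joining [w] and [s]. Both are near [p], so [s] and [t] coincide,
     although [b] is far from [s] and near [t]. *)
  assert (sub : forall w, far w p -> far w q).
  { intros w Fwp; apply NNPP; intros Nwq.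
    assert (pw : pt w) by (destruct Fwp as [? [? [? [? _]]]]; apply H0).
    assert (Fwb : far w b).
    { apply NNPP; intros Nwb; revert Fwp; apply H; auto.
      apply (near_line w q b y); auto. }
    destruct (one_near w p m Fwp pm) as [s [n' [sm [sn [wn [_ [n1 [n2 [Nws _]]]]]]]]].
    assert (Fbs : far b s) by (apply (far_line b z p s m); auto).
    assert (nzp : z <> p) by (intros ->; auto).
    assert (Nqs : near q s).
    { apply (near_line q z p m); auto using near_sym. }
    destruct (one_near b s n' Fbs sn) as [t [_ [tn [_ [_ [_ [_ [_ [Nbt _]]]]]]]]].
    assert (Nqt : near q t) by (apply (near_line q s w n'); auto using near_sym).
    assert (Ntp : near t p).
    { apply H; [apply tn|]; apply (near_line t q b y); auto using near_sym. }
    destruct (one_near p w n' (far_sym _ _ Fwp) wn) as [d [_ [_ [_ [_ [_ [_ [_ [_ U]]]]]]]]].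
    assert (s = t) as <-; [|auto].
    rewrite (U s), (U t); auto using near_sym.
    eapply collinear_near; eauto. }
  (* If [p] and [q] were distinct and collinear, some point would be far from [p] but near [q],
     against [sub]. *)
  exists q; split; [auto|].
  destruct (near_cases q p) as [E|[l [ql pl]]]; [apply qy|auto|auto|exact E|].
  destruct (classic (p = q)) as [->|npq]; [apply equiv_refl; auto|exfalso].
  destruct (far_one_side p q l pl ql npq) as [w [_ [F [_ [_ N]]]]].
  apply N, far_sym, sub, far_sym, F.
Qed.

(** A point near all of [y] is near [a] and [b], hence near every point on [x], in particular [p];
    this is the criterion of [on_of_double_perp]. *)
Lemma on_transfer a b x y p : on a x -> on b x -> on a y -> on b y -> ~ equiv a b ->
  on p x -> on p y.
Proof.
  intros ax bx ay b_y n px.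
  apply on_of_double_perp; [apply (on_pt _ _ px)|apply (on_line _ _ ay)|].
  intros t pt_t Ht.
  assert (Ht' : forall q, on q y -> near t q).
  { intros q [q' [qy E]]; apply (near_equiv t t q' q); auto using equiv_refl. }
  apply (near_line_on t a b x p); auto.
Qed.

Lemma two_points x p : ~ pt x -> exists a, inc a x /\ ~ equiv a p.
Proof.
  intros lx; destruct (point_on x lx) as [a ax].
  destruct (third_point a a x ax ax) as [b [bx [n _]]].
  destruct (classic (equiv a p)) as [E|nE]; [|exists a; auto].
  exists b; split; [auto|]; intros E'; apply n, collinear_equiv; [exists x; auto|].
  apply (equiv_trans b p); auto using equiv_sym.
Qed.

Definition same_trace (x y : V) : Prop := forall p, on p x <-> on p y.

Lemma same_trace_of_two a b x y : on a x -> on b x -> on a y -> on b y -> ~ equiv a b ->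
  same_trace x y.
Proof. intros ? ? ? ? ? p; split; apply (on_transfer a b); auto. Qed.

(** The ends of a weed are equivalent, so both lines carry the classes of [a] and [b]. *)
Lemma weed_same_trace a x b y c : weed adj opp pt a x b y c -> same_trace x y.
Proof.
  intros W; pose proof (weed_near _ _ _ _ _ W) as N; apply weed_inc in W.
  destruct W as [[ax [bx [b_y [cy [n1 n2]]]]] [_ nc]].
  assert (E : equiv a c) by (apply equiv_of_noncollinear; auto; [apply ax|apply cy]).
  apply (same_trace_of_two a b); auto using inc_on.
  - apply (on_equiv c); auto using equiv_sym, inc_on.
  - intros E'; apply n1, collinear_equiv; [exists x|]; auto.
Qed.

Lemma lsim_same_trace x y : lsim adj opp pt x y -> same_trace x y.
Proof.
  intros [lx [ly [a [u [b [v [c [W [Hx Hy]]]]]]]]].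
  pose proof (weed_same_trace _ _ _ _ _ W) as T.
  destruct W as [_ [_ [pa [pb [pc _]]]]].
  assert (Hx' : x = u \/ x = v).
  { simpl in Hx; intuition (subst; try contradiction; auto). }
  assert (Hy' : y = u \/ y = v).
  { simpl in Hy; intuition (subst; try contradiction; auto). }
  intros p; specialize (T p); destruct Hx' as [-> | ->], Hy' as [-> | ->]; tauto.
Qed.

(** Unless the lines coincide, [a], [x], [b], [y], [c] is a weed: its ends are near, so it is not
    straight at [b]. *)
Lemma lclass_of_meet a b c x y : inc b x -> inc b y -> inc a x -> inc c y ->
  equiv a c -> ~ equiv a b -> lclass adj opp pt x y.
Proof.
  intros bx b_y ax cy E n.
  assert (n1 : a <> b) by (intros ->; apply n, equiv_refl, bx).
  assert (n2 : b <> c) by (intros <-; auto).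
  destruct (classic (x = y)) as [->|nxy]; [apply rt_refl|apply rt_step].
  split; [apply (inc_line _ _ ax)|split; [apply (inc_line _ _ cy)|]].
  assert (nc : ~ collinear a c).
  { intros C; apply nxy; assert (a = c) as <- by (apply collinear_equiv; auto).
    apply (line_unique a b); auto. }
  exists a, x, b, y, c; split; [|simpl; tauto].
  apply weed_inc; split; [auto 10|split; [|auto]].
  intros o; apply (equiv_near_self a c E), (far_intro a x b y c); auto.
Qed.

(** A line [z] joining a point of [x] to a point of [y] meets each of them as in [lclass_of_meet],
    so two steps suffice. *)
Lemma lclass_of_two a b x y : on a x -> on b x -> on a y -> on b y -> ~ equiv a b ->
  lclass adj opp pt x y.
Proof.
  intros ax bx [a2 [a2y E2]] b_y n.
  destruct ax as [a1 [a1x E1]], bx as [b1 [b1x F1]], b_y as [b2 [b2y F2]].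
  assert (E : equiv a1 a2) by (apply (equiv_trans a1 a); auto using equiv_sym).
  assert (F : equiv b1 b2) by (apply (equiv_trans b1 b); auto using equiv_sym).
  assert (n1 : ~ equiv a1 b1).
  { intros X; apply n, (equiv_trans a a1); auto using equiv_sym.
    apply (equiv_trans a1 b1); auto. }
  assert (N : near b1 a2).
  { apply (near_equiv b1 b1 a1 a2); auto; [apply equiv_refl, b1x|].
    eapply collinear_near; eauto. }
  destruct (near_cases b1 a2) as [X|[z [b1z a2z]]]; [apply b1x|apply a2y|exact N| |].
  - destruct n1; apply (equiv_trans a1 a2); auto using equiv_sym.
  - apply (rt_trans _ _ x z y).
    + apply (lclass_of_meet a1 b1 a2); auto.
    + apply (lclass_of_meet b1 a2 b2); auto.
      intros X; apply n1, (equiv_trans a1 a2); auto using equiv_sym.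
Qed.

Lemma lclass_iff x y : ~ pt x -> lclass adj opp pt x y <-> ~ pt y /\ same_trace x y.
Proof.
  intros lx; split.
  - intros L; induction L as [x y S|x|x y z _ IH1 _ IH2].
    + split; [apply S|apply lsim_same_trace, S].
    + split; [auto|intros p; tauto].
    + destruct IH1 as [ly T1]; auto; destruct IH2 as [lz T2]; auto.
      split; auto; intros p; rewrite (T1 p); auto.
  - intros [ly T]; destruct (point_on x lx) as [a ax].
    destruct (two_points x a lx) as [b [bx n]].
    apply (lclass_of_two b a); auto using inc_on; apply T; auto using inc_on.
Qed.

(** * Opposition and flatness *)

(** Opposition of the classes of [x] and [y] at the class of [a], expressed by traces; [opp a] would
    require lines through [a] itself. *)
Definition local_opp (a x y : V) : Prop :=
  on a x /\ on a y /\ exists u v, on u x /\ on v y /\ far u v.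

(** The class of [a] is the only one on [x] near [v0], so [u] is far from [v0]; then it is also the
    only one on [y] near [u]. *)
Lemma local_opp_far a x y u v : local_opp a x y -> on u x -> on v y ->
  ~ equiv u a -> ~ equiv v a -> far u v.
Proof.
  intros [ax [ay [u0 [v0 [ux [vy F]]]]]] ux' vy' n n'.
  assert (F' : far v0 u).
  { apply (far_line_on v0 u0 a u x); auto using far_sym.
    apply (on_near v0 a y); auto. }
  apply (far_line_on u v0 a v y); auto using far_sym.
  apply (on_near u a x); auto.
Qed.

Lemma opp_local_opp b x y : pt b -> opp b x y -> local_opp b x y.
Proof.
  intros pb o; destruct (opp_inc _ _ _ pb o) as [bx [b_y _]].
  destruct (third_point b b x bx bx) as [p [px [n _]]].
  destruct (third_point b b y b_y b_y) as [q [qy [n' _]]].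
  split; [apply inc_on; auto|split; [apply inc_on; auto|]].
  exists p, q; repeat (split; [apply inc_on; solve [auto]|]).
  apply (far_intro p x b y q); auto.
Qed.

(** The projection of [p'] onto [y] is [b] and the joining line is [x], so the opposition supplied
    by [one_near] is the desired one. *)
Lemma opp_of_far b x y p q : inc b x -> inc b y -> on p x -> on q y -> far p q -> opp b x y.
Proof.
  intros bx b_y [p' [px E]] [q' [qy E']] F.
  assert (F' : far p' q') by (apply (far_equiv p p' q q'); auto using equiv_sym).
  destruct (one_near p' q' y F' qy) as [d [w [_ [dw [pw [o [n [_ [_ U]]]]]]]]].
  assert (b = d) as <- by (apply U; auto; apply (collinear_near p' b x); auto).
  rewrite (line_unique b p' x w); auto.
Qed.

(** * Opposite lines and the criterion for flatness *)

Definition line_root (x z : V) : Prop :=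
  exists a w b, inc a x /\ inc a w /\ inc b w /\ inc b z /\ a <> b /\ opp a x w /\ opp b w z.

Lemma opposite_inv x z : opposite adj opp 4 x z <->
  exists a w b, (adj x a /\ adj a w /\ adj w b /\ adj b z) /\
    (x <> w /\ a <> b /\ w <> z) /\ opp a x w /\ opp w a b /\ opp b w z.
Proof.
  split.
  - intros [r [[P Hlen] [[_ S] [Hhd Hlast]]]].
    destruct r as [|r0 [|a [|w [|b [|r4 [|? ?]]]]]]; try discriminate Hlen.
    injection Hhd as ->; simpl in *; subst r4; exists a, w, b; tauto.
  - intros [a [w [b H]]]; exists [x; a; w; b; z].
    unfold spath, straight, between; simpl; tauto.
Qed.

Lemma opposite_type x z : opposite adj opp 4 x z -> (pt x <-> pt z).
Proof.
  intros H; apply opposite_inv in H; destruct H as [a [w [b [[A1 [A2 [A3 A4]]] _]]]].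
  apply (gq_type _ _ _ GQ) in A1, A2, A3, A4; tauto.
Qed.

Lemma line_opp p q x : inc p x -> inc q x -> p <> q -> opp x p q.
Proof.
  intros px qx n; apply (gq_green _ _ _ GQ x (inc_line _ _ px)); auto;
    apply (gq_sym _ _ _ GQ); [apply px|apply qx].
Qed.

Lemma opposite_point a c : pt a -> opposite adj opp 4 a c <-> far a c.
Proof.
  intros pa; rewrite opposite_inv; split.
  - intros [x [b [y [[A1 [A2 [A3 A4]]] [[n1 [n2 n3]] [o1 [o2 o3]]]]]]].
    assert (ax : inc a x) by (split; auto).
    assert (bx : inc b x) by (apply inc_of_line; auto; apply (inc_line a); auto).
    assert (b_y : inc b y) by (split; [apply bx|auto]).
    assert (cy : inc c y) by (apply inc_of_line; auto; apply (inc_line b); auto).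
    apply (far_intro a x b y c); auto.
  - intros [x [b [y [ax [bx [b_y [cy [n1 [n2 o]]]]]]]]].
    exists x, b, y.
    destruct (opp_inc _ _ _ (proj1 bx) o) as [_ [_ [_ n3]]].
    assert (o1 := line_opp _ _ _ ax bx n1); assert (o2 := line_opp _ _ _ b_y cy n2).
    assert (s := gq_sym _ _ _ GQ); destruct ax, bx, b_y, cy; auto 10.
Qed.

Lemma opposite_line x z : ~ pt x -> opposite adj opp 4 x z <-> line_root x z.
Proof.
  intros lx; rewrite opposite_inv; split.
  - intros [a [w [b [[A1 [A2 [A3 A4]]] [[n1 [n2 n3]] [o1 [o2 o3]]]]]]].
    assert (ax : inc a x) by (apply inc_of_line; auto).
    assert (aw : inc a w) by (split; [apply ax|auto]).
    assert (bw : inc b w) by (apply inc_of_line; auto; apply (inc_line a); auto).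
    assert (bz : inc b z) by (split; [apply bw|auto]).
    exists a, w, b; auto 10.
  - intros [a [w [b [ax [aw [bw [bz [n [o1 o2]]]]]]]]].
    exists a, w, b.
    destruct (opp_inc _ _ _ (proj1 ax) o1) as [_ [_ [_ n3]]].
    destruct (opp_inc _ _ _ (proj1 bz) o2) as [_ [_ [_ n4]]].
    assert (o := line_opp _ _ _ aw bw n).
    assert (s := gq_sym _ _ _ GQ); destruct ax, aw, bw, bz; auto 10.
Qed.

(* Opposition of lines in terms of the traces of x and z alone. *)
Definition trace_opp (x z : V) : Prop :=
  exists a b, on a x /\ on b z /\ near a b /\
    (exists b', on b' z /\ far a b') /\ (exists a', on a' x /\ far a' b).

Lemma line_root_trace x z : line_root x z <-> trace_opp x z.
Proof.
  split.
  - intros [a [w [b [ax [aw [bw [bz [n [o1 o2]]]]]]]]].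
    exists a, b; split; [apply inc_on; auto|split; [apply inc_on; auto|]].
    split; [eapply collinear_near; eauto|].
    destruct (third_point b b z bz bz) as [b' [b'z [n1 _]]].
    destruct (third_point a a x ax ax) as [a' [a'x [n2 _]]].
    split; [exists b'|exists a']; (split; [apply inc_on; auto|]).
    + apply (far_intro a w b z b'); auto.
    + apply (far_intro a' x a w b); auto.
  - intros [a [b [[a1 [ax Ea]] [[b1 [bz Eb]] [N [[b' [b'z Fb]] [a' [a'x Fa]]]]]]]].
    assert (N1 : near a1 b1) by (apply (near_equiv a a1 b b1); auto using equiv_sym).
    assert (pb' : pt b') by apply (on_pt _ _ b'z).
    assert (pa' : pt a') by apply (on_pt _ _ a'x).
    assert (Fb1 : far a1 b').
    { apply (far_equiv a a1 b' b'); auto using equiv_sym, equiv_refl. }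
    assert (Fa1 : far a' b1).
    { apply (far_equiv a' a' b b1); auto using equiv_sym, equiv_refl. }
    assert (ne : ~ equiv a1 b1).
    { apply (far_not_equiv a1 b1 b'); [apply far_sym; auto|].
      apply (on_near b' b1 z); auto using inc_on. }
    destruct (near_cases a1 b1) as [?|[w [aw bw]]]; [apply ax|apply bz|auto|contradiction|].
    exists a1, w, b1; repeat (split; [solve [auto]|]); split; [|split].
    + intros ->; apply ne, equiv_refl, bz.
    + apply (opp_of_far a1 x w a' b1); auto using inc_on.
    + apply (opp_of_far b1 w z a1 b'); auto using inc_on.
Qed.

Lemma line_root_far x z r : line_root x z -> inc r z -> exists a, inc a x /\ far a r.
Proof.
  intros [a [w [b [ax [aw [bw [bz [n [o1 o2]]]]]]]]] rz.
  destruct (classic (r = b)) as [->|n1].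
  - destruct (third_point a a x ax ax) as [a' [a'x [n2 _]]].
    exists a'; split; [auto|]; apply (far_intro a' x a w b); auto.
  - exists a; split; [auto|]; apply (far_intro a w b z r); auto.
Qed.

(** By [on_of_double_perp] some [r] is near all of [x] but far from a point of [y]. Joining [r] to
    its projection onto [y] and taking [z] opposite the joining line at [r] gives a root from [y];
    every line opposite [x] has all its points far from some point of [x], which excludes [z]. *)
Lemma opposite_separates x y p : ~ pt x -> on p y -> ~ on p x ->
  exists z, opposite adj opp 4 y z /\ ~ opposite adj opp 4 x z.
Proof.
  intros lx [p' [py E]] nx.
  assert (nx' : ~ on p' x) by (intros H; apply nx, (on_equiv p'); auto).
  destruct (classic (exists r, pt r /\ (forall q, inc q x -> near r q) /\ far r p'))
    as [[r [pr [Hr F]]]|H].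
  - destruct (one_near r p' y F py) as [b [w [b_y [bw [rw [o [n _]]]]]]].
    destruct (common_opp r w w rw rw) as [z [oz _]].
    destruct (opp_inc _ _ _ pr oz) as [rz [_ [oz' _]]].
    exists z; split.
    + apply (opposite_line y z (inc_line _ _ py)); exists b, w, r; auto 10 using opp_sym.
    + intros O; apply (opposite_line x z lx) in O.
      destruct (line_root_far x z r O rz) as [a [ax Fa]].
      apply (Hr a ax), far_sym, Fa.
  - exfalso; apply nx', on_of_double_perp; [apply py|auto|].
    intros t pt_t Ht F; apply H; exists t; auto.
Qed.

(** Opposition of points depends only on their far points, and that of lines only on traces.
    Conversely, [opposite_separates] tells lines of different traces apart; a point and a line
    differ because opposite vertices have equal type and every point has an opposite. *)
Lemma flat_iff : flat adj opp 4 <->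
  (forall a b, equiv a b -> a = b) /\
  (forall x y, ~ pt x -> ~ pt y -> same_trace x y -> x = y).
Proof.
  split.
  - intros H; split.
    + intros a b [pa [pb E]]; apply H; intros z.
      rewrite (opposite_point a z), (opposite_point b z); auto.
    + intros x y lx ly T; apply H; intros z.
      rewrite (opposite_line x z), (opposite_line y z), !line_root_trace; auto.
      unfold trace_opp; split; intros [a [b [ax [bz [N [Hb [a' [a'x F]]]]]]]];
        exists a, b; (split; [apply T; auto|]); repeat (split; [solve [auto]|]);
        exists a'; (split; [apply T; auto|auto]).
  - intros [Hp Hl] x y H.
    assert (ex : forall v, pt v -> exists z, pt z /\ opposite adj opp 4 v z).
    { intros v pv; destruct (common_far v v pv pv) as [z [F _]].
      exists z; split; [|apply opposite_point; auto].
      destruct (far_sym _ _ F) as [? [? [? [i _]]]]; apply i. }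
    destruct (classic (pt x)) as [px|lx], (classic (pt y)) as [py|ly].
    + apply Hp; split; [auto|split; [auto|]]; intros z.
      rewrite <- (opposite_point x z), <- (opposite_point y z); auto.
    + destruct (ex x px) as [z [pz O]]; apply H, opposite_type in O; tauto.
    + destruct (ex y py) as [z [pz O]]; apply H, opposite_type in O; tauto.
    + apply Hl; auto; intros p; split; intros i; apply NNPP; intros n.
      * destruct (opposite_separates y x p) as [z [O1 O2]]; auto; apply O2, H, O1.
      * destruct (opposite_separates x y p) as [z [O1 O2]]; auto; apply O2, H, O1.
Qed.

(** * The quotient *)

(** A case distinction on the type of [v] makes [bar] one projection for points and lines alike. *)
Definition bar_set (v : V) : V -> Prop :=
  fun u => (pt v /\ psim adj opp pt v u) \/ (~ pt v /\ lclass adj opp pt v u).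

Lemma bar_set_pt a : pt a -> bar_set a = pclass adj opp pt a.
Proof.
  intros pa; apply functional_extensionality; intros u; apply propositional_extensionality.
  unfold bar_set, pclass; tauto.
Qed.

Lemma bar_set_line x : ~ pt x -> bar_set x = lclass adj opp pt x.
Proof.
  intros lx; apply functional_extensionality; intros u; apply propositional_extensionality.
  unfold bar_set; tauto.
Qed.

Lemma bar_set_class v : is_class adj opp pt (bar_set v).
Proof.
  destruct (classic (pt v)) as [pv|lv]; [left|right]; exists v; split; auto.
  - apply bar_set_pt, pv.
  - apply bar_set_line, lv.
Qed.

Definition bar (v : V) : Vbar adj opp pt := exist _ (bar_set v) (bar_set_class v).

Lemma Vbar_ext (C D : Vbar adj opp pt) : proj1_sig C = proj1_sig D -> C = D.
Proof.
  destruct C as [C HC], D as [D HD]; simpl; intros ->; f_equal; apply proof_irrelevance.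
Qed.

Lemma bar_surj C : exists v, C = bar v.
Proof.
  destruct C as [C HC]; destruct HC as [[a [pa E]]|[x [lx E]]]; [exists a|exists x];
    apply Vbar_ext; simpl; rewrite E; symmetry; [apply bar_set_pt|apply bar_set_line]; auto.
Qed.

Lemma bar_set_refl v : bar_set v v.
Proof.
  destruct (classic (pt v)); [left; split; [auto|left; auto]|right; split; [auto|apply rt_refl]].
Qed.

Lemma bar_set_pt_iff a u : pt a -> bar_set a u <-> equiv a u.
Proof. intros pa; rewrite bar_set_pt; auto; apply psim_equiv; auto. Qed.

Lemma bar_set_line_iff x u : ~ pt x -> bar_set x u <-> ~ pt u /\ same_trace x u.
Proof. intros lx; rewrite bar_set_line; auto; apply lclass_iff; auto. Qed.

Lemma ptbar_bar v : ptbar adj opp pt (bar v) <-> pt v.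
Proof.
  split.
  - intros [a [pa E]]; simpl in E; apply NNPP; intros lv.
    pose proof (bar_set_refl a) as H; rewrite (bar_set_pt a pa), <- E in H.
    apply (bar_set_line_iff v a lv) in H; tauto.
  - intros pv; exists v; split; [auto|apply bar_set_pt; auto].
Qed.

Lemma linebar_bar v : linebar adj opp pt (bar v) <-> ~ pt v.
Proof.
  split.
  - intros [x [lx E]] pv; simpl in E.
    pose proof (bar_set_refl x) as H; rewrite (bar_set_line x lx), <- E in H.
    apply (bar_set_pt_iff v x pv) in H; apply lx, H.
  - intros lv; exists v; split; [auto|apply bar_set_line; auto].
Qed.

Lemma bar_eq_pt a b : pt a -> bar a = bar b <-> equiv a b.
Proof.
  intros pa; split.
  - intros E; apply bar_set_pt_iff; auto; change (proj1_sig (bar a) b); rewrite E.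
    apply bar_set_refl.
  - intros E; apply Vbar_ext; simpl.
    apply functional_extensionality; intros u; apply propositional_extensionality.
    rewrite !bar_set_pt_iff; [|apply E|auto].
    split; intros E'; [apply (equiv_trans b a)|apply (equiv_trans a b)]; auto using equiv_sym.
Qed.

Lemma bar_eq_line x y : ~ pt x -> ~ pt y -> bar x = bar y <-> same_trace x y.
Proof.
  intros lx ly; split.
  - intros E; apply (bar_set_line_iff x y lx); change (proj1_sig (bar x) y); rewrite E.
    apply bar_set_refl.
  - intros E; apply Vbar_ext; simpl.
    apply functional_extensionality; intros u; apply propositional_extensionality.
    rewrite !bar_set_line_iff; auto.
    split; intros [? E']; (split; [auto|]); intros p; rewrite <- (E' p); [symmetry|]; apply E.
Qed.

(** * Incidence, local opposition and plumpness in the quotient *)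

Local Notation adjb := (adjbar adj opp pt).
Local Notation oppb := (oppbar adj opp pt).
Local Notation ptb := (ptbar adj opp pt).

Lemma adjbar_sym C D : adjb C D -> adjb D C.
Proof.
  intros [T [u [v [Cu [Dv A]]]]]; split; [tauto|].
  exists v, u; repeat (split; [auto|]); apply (gq_sym _ _ _ GQ); auto.
Qed.

Lemma adjbar_type C D : adjb C D -> (ptb C <-> ~ ptb D).
Proof.
  destruct (bar_surj C) as [c ->], (bar_surj D) as [d ->]; intros [T _].
  rewrite !ptbar_bar, !linebar_bar in *; tauto.
Qed.

Lemma adjbar_bar a x : pt a -> ~ pt x -> adjb (bar a) (bar x) <-> on a x.
Proof.
  intros pa lx; split.
  - intros [_ [u [v [Cu [Dv A]]]]]; simpl in Cu, Dv.
    apply bar_set_pt_iff in Cu; auto; apply bar_set_line_iff in Dv as [lv T]; auto.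
    apply (on_equiv u); [apply T, inc_on; split; [apply Cu|auto]|apply equiv_sym; auto].
  - intros [a' [i E]]; split; [left; rewrite ptbar_bar, linebar_bar; auto|].
    exists a', x; split; [apply bar_set_pt_iff; auto using equiv_sym|].
    split; [apply bar_set_refl|apply i].
Qed.

Lemma adjbar_pt a D : pt a -> adjb (bar a) D -> exists x, ~ pt x /\ D = bar x /\ on a x.
Proof.
  intros pa A; destruct (bar_surj D) as [x ->].
  assert (lx : ~ pt x).
  { apply adjbar_type in A; rewrite !ptbar_bar in A; tauto. }
  exists x; rewrite <- adjbar_bar; auto.
Qed.

Lemma adjbar_line x D : ~ pt x -> adjb (bar x) D -> exists a, pt a /\ D = bar a /\ on a x.
Proof.
  intros lx A; destruct (bar_surj D) as [a ->].
  assert (pa : pt a).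
  { apply adjbar_type in A; rewrite !ptbar_bar in A; apply NNPP; tauto. }
  exists a; rewrite <- adjbar_bar; auto using adjbar_sym.
Qed.

Lemma adjbar_of_adj u v : adj u v -> adjb (bar u) (bar v).
Proof.
  intros A; pose proof (gq_type _ _ _ GQ _ _ A) as T.
  split; [rewrite !ptbar_bar, !linebar_bar|].
  - destruct (classic (pt u)); tauto.
  - exists u, v; repeat split; auto; apply bar_set_refl.
Qed.

Lemma oppbar_line x C D : ~ pt x ->
  oppb (bar x) C D <-> adjb (bar x) C /\ adjb (bar x) D /\ C <> D.
Proof.
  intros lx; unfold oppbar; rewrite linebar_bar, ptbar_bar; tauto.
Qed.

(** A point of [x] not equivalent to [b] is near [b], hence collinear with it, and the joining line
    shares two classes with [x]. Thus every representative of a point class sees all line classes at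
    it. *)
Lemma same_trace_line_through b x : on b x -> exists u, inc b u /\ same_trace x u.
Proof.
  intros bx; pose proof (on_line _ _ bx) as lx; pose proof (on_pt _ _ bx) as pb.
  destruct (two_points x b lx) as [d [dx n]].
  assert (N : near b d) by (apply (on_near b d x); auto using inc_on).
  destruct (near_cases b d) as [E|[u [bu du]]]; [auto|apply dx|auto| |].
  - destruct n; apply equiv_sym, E.
  - exists u; split; [auto|]; apply (same_trace_of_two d b); auto using inc_on.
Qed.

(** The universal condition in [oppbar] is never vacuous: at any [b] in the class there are lines of
    both classes, and points on them witness [local_opp]. *)
Lemma oppbar_pt a x y : pt a -> ~ pt x -> ~ pt y ->
  oppb (bar a) (bar x) (bar y) <-> local_opp a x y.
Proof.
  intros pa lx ly; unfold oppbar.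
  rewrite linebar_bar, ptbar_bar, (adjbar_bar a x), (adjbar_bar a y); auto; split.
  - intros [ax [ay [[? _]|[_ [b [Ab H]]]]]]; [contradiction|].
    simpl in Ab; apply bar_set_pt_iff in Ab; auto.
    destruct (same_trace_line_through b x) as [u [bu Tu]]; [apply (on_equiv a); auto|].
    destruct (same_trace_line_through b y) as [v [bv Tv]]; [apply (on_equiv a); auto|].
    assert (o : opp b u v).
    { apply H; [apply bu| |apply bv|]; apply bar_set_line_iff; auto;
        (split; [eapply inc_line; eauto|auto]). }
    destruct (opp_local_opp b u v (proj1 bu) o) as [_ [_ [p [q [pu [qv F]]]]]].
    split; [auto|split; [auto|]]; exists p, q.
    split; [apply Tu; auto|split; [apply Tv; auto|auto]].
  - intros [ax [ay [p [q [px [qy F]]]]]]; split; [auto|split; [auto|right; split; [auto|]]].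
    (* Any representative would do as the witness, since [opp_of_far] looks only at traces. *)
    exists a; split; [apply bar_set_refl|]; intros u v au Cu av Dv.
    apply bar_set_line_iff in Cu as [lu Tu], Dv as [lv Tv]; auto.
    apply (opp_of_far a u v p q); auto; try (split; auto); [apply Tu; auto|apply Tv; auto].
Qed.

Lemma local_opp_sym a x y : local_opp a x y -> local_opp a y x.
Proof.
  intros [ax [ay [u [v [ux [vy F]]]]]]; split; [auto|split; [auto|]].
  exists v, u; auto using far_sym.
Qed.

Lemma local_opp_irrefl a x : ~ local_opp a x x.
Proof. intros [_ [_ [u [v [ux [vx F]]]]]]; exact (on_near u v x ux vx F). Qed.

Lemma oppbar_rel C : opp_rel_at adjb oppb C.
Proof.
  destruct (bar_surj C) as [c ->]; split; [|split].
  - intros D E [H1 [H2 _]]; auto.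
  - intros D E o; destruct (classic (pt c)) as [pc|lc].
    + pose proof o as [H1 [H2 _]].
      destruct (adjbar_pt _ _ pc H1) as [x [lx [-> _]]], (adjbar_pt _ _ pc H2) as [y [ly [-> _]]].
      apply oppbar_pt in o; auto; apply oppbar_pt; auto using local_opp_sym.
    + apply oppbar_line in o; auto; apply oppbar_line; intuition.
  - intros D o; destruct (classic (pt c)) as [pc|lc].
    + pose proof o as [H1 _].
      destruct (adjbar_pt _ _ pc H1) as [x [lx [-> _]]].
      apply oppbar_pt in o; auto; exact (local_opp_irrefl _ _ o).
    + apply oppbar_line in o; tauto.
Qed.

Lemma adjbar_lift c D : adjb (bar c) D -> exists d, adj c d /\ D = bar d.
Proof.
  intros A; destruct (classic (pt c)) as [pc|lc].
  - destruct (adjbar_pt _ _ pc A) as [x [lx [-> i]]].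
    destruct (same_trace_line_through c x i) as [u [cu T]].
    exists u; split; [apply cu|apply bar_eq_line; auto; eapply inc_line; eauto].
  - destruct (adjbar_line _ _ lc A) as [a [pa [-> [a' [i E]]]]].
    exists a'; split; [apply (gq_sym _ _ _ GQ), i|apply bar_eq_pt; auto using equiv_sym].
Qed.

Lemma adjbar_lift_list c (S : list (Vbar adj opp pt)) : (forall D, In D S -> adjb (bar c) D) ->
  exists S', length S' = length S /\ (forall d, In d S' -> adj c d) /\
    forall D, In D S -> exists d, In d S' /\ D = bar d.
Proof.
  induction S as [|D S IH]; intros H.
  - exists []; simpl; split; [auto|split; [tauto|tauto]].
  - destruct IH as [S' [L [A U]]]; [intros E HE; apply H; simpl; auto|].
    destruct (adjbar_lift c D) as [d [cd ->]]; [apply H; simpl; auto|].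
    exists (d :: S'); simpl; split; [auto|split].
    + intros e [<-|He]; auto.
    + intros E [<-|HE]; [exists d; auto|].
      destruct (U E HE) as [e [He ->]]; exists e; auto.
Qed.

Lemma oppbar_of_opp c d e : opp c d e -> oppb (bar c) (bar d) (bar e).
Proof.
  intros o; destruct (opp_adj _ _ _ _ _ (gq_opp _ _ _ GQ) o) as [cd [ce [_ n]]].
  destruct (classic (pt c)) as [pc|lc].
  - apply oppbar_pt; auto; [| |apply opp_local_opp; auto];
      apply (inc_line c); split; auto.
  - apply oppbar_line; auto; split; [apply adjbar_of_adj; auto|].
    split; [apply adjbar_of_adj; auto|].
    assert (id : inc d c) by (apply inc_of_line; auto).
    rewrite bar_eq_pt; [|apply id]; intros E; apply n, collinear_equiv; auto.
    exists c; split; auto; apply inc_of_line; auto.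
Qed.

(** A finite set of neighbours lifts to neighbours of one representative [c], and opposition at [c]
    passes to the quotient. *)
Lemma kplump_bar k : kplump adj opp k -> kplump adjb oppb k.
Proof.
  intros H C S HS A; destruct (bar_surj C) as [c ->].
  destruct (adjbar_lift_list c S A) as [S' [L [A' U]]].
  destruct (H c S') as [m [cm Hm]]; [rewrite L; auto|auto|].
  exists (bar m); split; [apply adjbar_of_adj; auto|].
  intros D HD; destruct (U D HD) as [d [Hd ->]]; apply oppbar_of_opp; auto.
Qed.

Lemma connected_bar : connected adjb.
Proof.
  intros C D; destruct (bar_surj C) as [c ->], (bar_surj D) as [d ->].
  destruct (gq_connected _ _ _ GQ c d) as [w [Hw [Hhd Hlast]]].
  exists (map bar w); split; [|split].
  - clear Hhd Hlast; induction w as [|u [|v w] IH]; [contradiction|exact I|].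
    destruct Hw as [A Hw]; split; [apply adjbar_of_adj; auto|apply IH, Hw].
  - destruct w; [discriminate|]; injection Hhd as ->; reflexivity.
  - rewrite <- Hlast; clear; induction w as [|u [|v w] IH]; simpl in *; auto.
Qed.

Lemma green_bar : green adjb oppb ptb.
Proof.
  intros C lC D E A1 A2 n; destruct (bar_surj C) as [c ->].
  apply oppbar_line; auto; intros pc; apply lC, ptbar_bar, pc.
Qed.

Lemma green_quadrangle_bar : green_quadrangle adjb oppb ptb.
Proof.
  assert (pbar : forall C, ptb C -> exists a, C = bar a /\ pt a).
  { intros C pC; destruct (bar_surj C) as [a ->]; exists a; split; auto; apply ptbar_bar, pC. }
  assert (neq : forall a b, pt a -> bar a <> bar b -> ~ equiv a b).
  { intros a b pa n E; apply n, bar_eq_pt; auto. }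
  split.
  - exact adjbar_sym.
  - exact adjbar_type.
  - exact oppbar_rel.
  - exact green_bar.
  - apply kplump_bar, (gq_plump _ _ _ GQ).
  - exact connected_bar.
  - intros A B X Y pA pB AX BX AY BY n.
    destruct (pbar A pA) as [a [-> pa]], (pbar B pB) as [b [-> pb]].
    destruct (adjbar_pt _ _ pa AX) as [x [lx [-> ax]]].
    destruct (adjbar_pt _ _ pa AY) as [y [ly [-> ay]]].
    apply adjbar_bar in BX, BY; auto.
    apply bar_eq_line; auto; apply (same_trace_of_two a b); auto.
  - intros A X B X' B' Y pA AX BX n o AX' BX' n' o'.
    destruct (pbar A pA) as [a [-> pa]].
    destruct (adjbar_pt _ _ pa AX) as [x [lx [-> ax]]].
    destruct (adjbar_pt _ _ pa AX') as [x' [lx' [-> ax']]].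
    apply adjbar_sym in BX, BX'.
    destruct (adjbar_line _ _ lx BX) as [b [pb [-> bx]]].
    destruct (adjbar_line _ _ lx' BX') as [b' [pb' [-> bx']]].
    destruct (adjbar_pt _ _ pb (proj1 (proj2 o))) as [y [ly [-> b_y]]].
    pose proof (proj1 (proj2 o')) as b_y'; apply adjbar_bar in b_y'; auto.
    apply oppbar_pt in o; auto.
    (* If [b] and [b'] were inequivalent, opposition at [b] would make [a] and [b'] far, but both
       are on [x']. *)
    apply bar_eq_pt; auto; apply NNPP; intros nE.
    apply (on_near a b' x'); auto.
    apply (local_opp_far b x y); auto using equiv_sym.
  - intros A X B Y C Z pA AX BX n1 o1 CY n2 o2.
    destruct (pbar A pA) as [a [-> pa]].
    destruct (adjbar_pt _ _ pa AX) as [x [lx [-> ax]]].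
    apply adjbar_sym in BX, CY.
    destruct (adjbar_line _ _ lx BX) as [b [pb [-> bx]]].
    destruct (adjbar_pt _ _ pb (proj1 (proj2 o1))) as [y [ly [-> b_y]]].
    destruct (adjbar_line _ _ ly CY) as [c [pc [-> cy]]].
    destruct (adjbar_pt _ _ pc (proj1 (proj2 o2))) as [z [lz [-> cz]]].
    apply oppbar_pt in o1, o2; auto.
    assert (F : far a c) by (apply (local_opp_far b x y); auto using equiv_sym).
    (* The octagon is completed by the projection [e] of [a] onto [z] and the line [w] joining it to
       [a]. *)
    destruct (one_near_on a c z F cz) as [e [w [ez [ew [aw [o [n3 [n4 _]]]]]]]].
    assert (pe : pt e) by apply ez.
    assert (lw : ~ pt w) by apply (inc_line _ _ ew).
    exists (bar e), (bar w).
    split; [apply adjbar_bar; auto using inc_on|].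
    split; [apply adjbar_bar; auto using inc_on|].
    split; [apply adjbar_bar; auto using inc_on|].
    split; [rewrite bar_eq_pt; auto using equiv_sym|].
    split; [rewrite bar_eq_pt; auto using equiv_sym|].
    split; [apply oppbar_of_opp, opp_sym; auto|].
    apply oppbar_pt; auto; split; [apply inc_on; auto|split; [auto|]].
    (* These two points are far because they lie on the lines [z] and [y], which are opposite at
       [c]. *)
    exists e, b; split; [apply inc_on; auto|split; [auto|]].
    apply far_sym, (local_opp_far c y z); auto using inc_on, equiv_sym.
Qed.

End Geometry.

(** * Opposite points and flatness in the quotient *)

Section Quotient.
Context {V : Type} (adj : V -> V -> Prop) (opp : V -> V -> V -> Prop) (pt : V -> Prop).
Context (GQ : green_quadrangle adj opp pt).

Local Notation adjb := (adjbar adj opp pt).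
Local Notation oppb := (oppbar adj opp pt).
Local Notation ptb := (ptbar adj opp pt).
Local Notation bar := (bar adj opp pt).

Lemma inc_bar a x : pt a -> ~ pt x -> inc adjb ptb (bar a) (bar x) <-> on adj opp pt a x.
Proof.
  intros pa lx; unfold inc; rewrite (ptbar_bar adj opp pt GQ), (adjbar_bar adj opp pt GQ); tauto.
Qed.

(** A root of the quotient comes back through [local_opp_far]; a root upstairs maps to a root
    because its distinct collinear points are inequivalent. *)
Lemma far_bar a c : pt a -> pt c ->
  far adjb oppb ptb (bar a) (bar c) <-> far adj opp pt a c.
Proof.
  intros pa pc; split.
  - intros [X [B [Y [[_ aX] [[pB bX] [[_ bY] [[_ cY] [n1 [n2 o]]]]]]]]].
    destruct (bar_surj adj opp pt B) as [b ->].
    apply (ptbar_bar adj opp pt GQ) in pB as pb.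
    destruct (adjbar_pt adj opp pt GQ _ _ pb bX) as [x [lx [-> bx]]].
    destruct (adjbar_pt adj opp pt GQ _ _ pb bY) as [y [ly [-> b_y]]].
    apply (adjbar_bar adj opp pt GQ) in aX, cY; auto.
    apply (oppbar_pt adj opp pt GQ) in o; auto.
    apply (local_opp_far adj opp pt GQ b x y); auto;
      intros E; apply (bar_eq_pt adj opp pt GQ) in E; auto.
  - intros [x [b [y [ax [bx [b_y [cy [n1 [n2 o]]]]]]]]].
    assert (lx := inc_line adj opp pt GQ _ _ ax); assert (ly := inc_line adj opp pt GQ _ _ cy).
    assert (pb : pt b) by apply bx.
    apply (far_intro adjb oppb ptb) with (x := bar x) (b := bar b) (y := bar y);
      try (apply inc_bar; auto; apply (inc_on adj opp pt); auto).
    + intros E; apply n1, (collinear_equiv adj opp pt GQ); [exists x; auto|].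
      apply (bar_eq_pt adj opp pt GQ); auto.
    + intros E; apply n2, (collinear_equiv adj opp pt GQ); [exists y; auto|].
      apply (bar_eq_pt adj opp pt GQ); auto.
    + apply oppbar_of_opp; auto.
Qed.

(** By [far_bar], equivalent points of the quotient are equal. Hence traces in the quotient
    correspond to traces upstairs, and these determine the line classes. *)
Lemma flat_bar : flat adjb oppb 4.
Proof.
  apply (flat_iff adjb oppb ptb (green_quadrangle_bar adj opp pt GQ)).
  assert (eq_pt : forall A B, equiv adjb oppb ptb A B -> A = B).
  { intros A B [pA [pB E]].
    destruct (bar_surj adj opp pt A) as [a ->], (bar_surj adj opp pt B) as [b ->].
    apply (ptbar_bar adj opp pt GQ) in pA, pB.
    apply (bar_eq_pt adj opp pt GQ); auto; split; [auto|split; [auto|]].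
    intros z; destruct (classic (pt z)) as [pz|lz].
    - rewrite <- !far_bar; auto.
    - assert (nf : forall c, ~ far adj opp pt c z) by (intros c [? [? [? [_ [_ [_ [H _]]]]]]]; apply lz, H).
      split; intros F; destruct (nf _ F). }
  split; [exact eq_pt|].
  intros X Y lX lY T.
  destruct (bar_surj adj opp pt X) as [x ->], (bar_surj adj opp pt Y) as [y ->].
  rewrite (ptbar_bar adj opp pt GQ) in lX, lY.
  apply (bar_eq_line adj opp pt GQ); auto.
  assert (on_bar : forall p z, pt p -> ~ pt z ->
    on adjb oppb ptb (bar p) (bar z) <-> on adj opp pt p z).
  { intros p z pp lz; rewrite <- inc_bar; auto; split.
    - intros [P [i E]]; rewrite <- (eq_pt _ _ E); exact i.
    - apply (inc_on adjb oppb ptb). }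
  intros p; split; intros i; pose proof (on_pt adj opp pt _ _ i) as pp;
    apply on_bar; auto; apply T, on_bar; auto.
Qed.

End Quotient.

Theorem mainTheorem14 (V : Type) (adj : V -> V -> Prop)
  (opp : V -> V -> V -> Prop) (pt : V -> Prop) :
  veldkamp_quadrangle adj opp pt -> green adj opp pt ->
  (veldkamp_quadrangle (adjbar adj opp pt) (oppbar adj opp pt) (ptbar adj opp pt) /\
   green (adjbar adj opp pt) (oppbar adj opp pt) (ptbar adj opp pt) /\
   flat (adjbar adj opp pt) (oppbar adj opp pt) 4) /\
  (flat adj opp 4 <->
     (forall a, pt a -> forall b, pclass adj opp pt a b -> b = a) /\
     (forall x, ~ pt x -> forall y, lclass adj opp pt x y -> y = x)) /\
  (forall k, 3 <= k -> kplump adj opp k ->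
     kplump (adjbar adj opp pt) (oppbar adj opp pt) k).
Proof.
  intros HQ HG; pose proof (green_quadrangle_of_veldkamp adj opp pt HQ HG) as GQ.
  split; [split; [|split]|split].
  - apply veldkamp_of_green_quadrangle, green_quadrangle_bar, GQ.
  - apply green_bar, GQ.
  - apply flat_bar, GQ.
  (* Singleton classes are the two conditions of [flat_iff], read through [psim_equiv] and
     [lclass_iff]. *)
  - rewrite (flat_iff adj opp pt GQ); split; intros [Hp Hl]; split.
    + intros a pa b E; symmetry; apply Hp, (psim_equiv adj opp pt GQ); auto.
    + intros x lx y L; apply (lclass_iff adj opp pt GQ) in L as [ly T]; auto.
      symmetry; auto.
    + intros a b E; symmetry; apply Hp; [apply E|].
      apply (psim_equiv adj opp pt GQ); [apply E|auto].
    + intros x y lx ly T; symmetry; apply Hl; auto.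
      apply (lclass_iff adj opp pt GQ); auto.
  - intros k _; apply kplump_bar, GQ.
Qed.
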